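(* Let $\Bbbk$ be a field, $R=\Bbbk[x_1,\ldots,x_n]$ with its standard $\mathbb{Z}^n$-grading, and let $N\subsetneq R$ be a monomial ideal with minimal monomial generators $m_1,\ldots,m_r$. If $N$ is a Scarf ideal, then $N$ is lattice-linear. In particular, if $P(\Delta_N)$ denotes the face poset (including the empty face) of the Scarf simplicial complex $\Delta_N$ and $\eta:P(\Delta_N)\to\mathbb{N}^n$ is the map of posets $I\mapsto\deg(m_I)$, then $\mathbb{F}(\eta)$ is a minimal multigraded free resolution of $R/N$.
   Context: **Scarf ideals.** For $I\subseteq\{1,\ldots,r\}$ put $m_I=\operatorname{lcm}(m_i:i\in I)$, with $m_\emptyset=1$; $\deg$ of a monomial is its exponent vector in $\mathbb{N}^n$. The Scarf complex is $\Delta_N=\{I\subseteq\{1,\ldots,r\}: m_I\ne m_J\text{ for all }J\subseteq\{1,\ldots,r\},\ J\neq I\}$, a simplicial complex. $N$ is a *Scarf ideal* if its minimal free resolution is supported on $\Delta_N$. That is, the following complex is a minimal free resolution of $R/N$: in homological degree $i$ it is the free module with basis $\{e_I: I\in\Delta_N,\ |I|=i\}$, where $\deg e_I=\deg m_I$, and its differential is $e_I\mapsto\sum_{j=1}^{|I|}(-1)^{j+1}\frac{m_I}{m_{I\setminus\{i_j\}}}e_{I\setminus\{i_j\}}$ for $I=\{i_1<\cdots<i_{|I|}\}$. **LCM-lattice.** $L_N$ is the set of all $m_I$, $I\subseteq\{1,\ldots,r\}$, ordered by divisibility. Monomials are identified with their degrees, so $L_N\subset\mathbb{N}^n$. If $\mathbb{F}$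 is the minimal multigraded free resolution of $R/N$, then the degrees of the elements of any multihomogeneous basis of any $F_i$ lie in $L_N$. **Lattice-linear.** Let $\mathbb{F}$ be a minimal multigraded free resolution of $R/N$ with differential $\partial^{\mathbb{F}}$. $N$ is *lattice-linear* if multihomogeneous bases $B_k$ of $F_k$ can be fixed for all $k$ so that for any $i\ge 1$ and any $v\in B_i$, writing $\partial^{\mathbb{F}}(v)=\sum_{v'\in B_{i-1}}m_{v,v'}\cdot v'$, one has: if $m_{v,v'}\neq 0$ then $\deg(v')\lessdot\deg(v)$ in $L_N$. (Here $\lambda\lessdot\alpha$ means that $\alpha$ covers $\lambda$.) **The sequence $C_\bullet(P)$.** Let $P$ be a finite poset with least element $\hat 0$ and set of atoms $S=\{a:\hat 0\lessdot a\}$. Simplicial complexes may be void (no faces, all reduced homology $0$) or equal to $\{\emptyset\}$ (reduced homology $\Bbbk$ in degree $-1$ only); $\widetilde H$ is reduced simplicial homology. For $\alpha\in P$ let $\mathbf{D}_\alpha$ be the simplicial complex of all chains (including the empty one) in $(\hat 0,\alpha]$, and let $\Delta_\alpha=\bigcup_{\lambda\lessdot\alpha}\mathbf{D}_\lambda$; for $\alpha\ne\hat 0$ this is the order complex of the open interval $(\hat 0,\alpha)$. For $\lambda\lessdot\alpha$ let $\Delta_{\alpha,\lambda}=\mathbf{D}_\lambda\cap\bigcup_{\beta\lessdot\alpha,\ \beta\neq\lambda}\mathbf{D}_\beta\subset\Delta_\lambda$. Set $C_0=\widetilde H_{-1}(\{\emptyset\},\Bbbk)\cong\Bbbk$. For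 $i\ge1$ and $\alpha\ne\hat 0$ set $C_{i,\alpha}=\widetilde H_{i-2}(\Delta_\alpha,\Bbbk)$ and $C_i=\bigoplus_{\alpha\in P\setminus\{\hat 0\}}C_{i,\alpha}$. Thus $C_{1,\alpha}=\widetilde H_{-1}(\{\emptyset\},\Bbbk)$ if $\alpha\in S$, and $C_{1,\alpha}=0$ otherwise. The map $\varphi_1:C_1\to C_0$ is the identity of $\widetilde H_{-1}(\{\emptyset\},\Bbbk)$ on each $C_{1,\alpha}$, $\alpha\in S$. For $i\ge2$, $\varphi_i:C_i\to C_{i-1}$ is given by $\varphi_i|_{C_{i,\alpha}}=\sum_{\lambda\lessdot\alpha}\varphi_i^{\alpha,\lambda}$, where $\varphi_i^{\alpha,\lambda}:C_{i,\alpha}\to C_{i-1,\lambda}$ (zero for $\lambda=\hat 0$) is the composition $$\widetilde H_{i-2}(\Delta_\alpha,\Bbbk)\xrightarrow{\ \delta\ }\widetilde H_{i-3}(\Delta_{\alpha,\lambda},\Bbbk)\xrightarrow{\ \iota\ }\widetilde H_{i-3}(\Delta_\lambda,\Bbbk).$$ Here $\delta$ is the Mayer–Vietoris connecting homomorphism for $\Delta_\alpha=\mathbf{D}_\lambda\cup\bigcup_{\beta\lessdot\alpha,\beta\ne\lambda}\mathbf{D}_\beta$ (it sends $[c]$ to $[d(c')]$, where $c=c'+c''$ with $c'$ supported on $\mathbf{D}_\lambda$ and $c''$ supported on the other part, and $d$ is the simplicial boundary), and $\iota$ is induced by inclusion. **The sequence $\mathbb{F}(\eta)$.** For a map of posets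 $\eta:P\to\mathbb{N}^n$, $\mathbb{F}(\eta)$ is the sequence $\cdots\to F_i\xrightarrow{\partial_i}F_{i-1}\to\cdots\to F_1\xrightarrow{\partial_1}F_0$ with: - $F_0=R\otimes_\Bbbk C_0$, where $\deg(x^\alpha\otimes v)=\alpha$; - for $i\ge1$, $F_i=\bigoplus_{\hat 0\ne\lambda\in P}F_{i,\lambda}$, $F_{i,\lambda}=R\otimes_\Bbbk C_{i,\lambda}$, where $\deg(x^\alpha\otimes v)=\alpha+\eta(\lambda)$ for $v\in C_{i,\lambda}$; - $\partial_1|_{F_{1,\lambda}}=x^{\eta(\lambda)}\otimes\varphi_1|_{C_{1,\lambda}}$; - for $i\ge2$, $\partial_i|_{F_{i,\alpha}}=\sum_{\lambda\lessdot\alpha}x^{\eta(\alpha)-\eta(\lambda)}\otimes\varphi_i^{\alpha,\lambda}$. In the claim $P=P(\Delta_N)$, ordered by inclusion, with $\hat 0=\emptyset$. *)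

(* Defs.v *)
From HB Require Import structures.
From mathcomp Require Import all_boot all_order all_algebra.
From mathcomp.multinomials Require Import mpoly.

Set Implicit Arguments.
Unset Strict Implicit.
Unset Printing Implicit Defensive.

Import Order.Theory GRing.Theory.
Local Open Scope ring_scope.

(** * Reduced simplicial homology with coefficients in a field

   A simplicial complex on the finite vertex set [T] is a set of faces
   [D : {set {set T}}] closed under inclusion; the void complex is [set0] and
   the complex {emptyset} is [[set set0]].  Faces are graded by cardinality:
   [chains D q], [cycles D q], ... live in simplicial dimension q - 1.  All
   complexes on [T] share one ambient chain space, and simplices are oriented
   by the enumeration order of [T]. *)

Section SimplicialHomology.

Variables (k : fieldType) (T : finType).
Implicit Types (D E : {set {set T}}) (F : {set T}).

Local Notation chain := {ffun {set T} -> k^o}.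

Definition simplex F : chain := [ffun G => (G == F)%:R].

Definition bd_simplex F : chain :=
  \sum_(v in F)
    (-1) ^+ #|[set w in F | (enum_rank w < enum_rank v)%N]| *: simplex (F :\ v).

Definition bd_fun (c : chain) : chain := \sum_F c F *: bd_simplex F.

Lemma bd_fun_linear : linear bd_fun.
Proof.
move=> a c c'; rewrite /bd_fun scaler_sumr -big_split /=.
by apply: eq_bigr => F _; rewrite !ffunE scalerDl scalerA.
Qed.
HB.instance Definition _ := GRing.isLinear.Build k _ _ _ bd_fun
  bd_fun_linear.

Definition bd : 'End(chain) := linfun bd_fun.

Definition restr_fun D (c : chain) : chain :=
  [ffun F => if F \in D then c F else 0].

Lemma restr_fun_linear D : linear (restr_fun D).
Proof.
move=> a c c'; apply/ffunP=> F; rewrite !ffunE.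
by case: ifP => // _; rewrite scaler0 addr0.
Qed.
HB.instance Definition _ D := GRing.isLinear.Build k _ _ _ (restr_fun D)
  (restr_fun_linear D).

Definition restr D : 'End(chain) := linfun (restr_fun D).

Definition chains D (q : nat) : {vspace chain} :=
  <<[seq simplex F | F <- enum D & #|F| == q]>>%VS.

Definition cycles D q : {vspace chain} := (chains D q :&: lker bd)%VS.

Definition boundaries D q : {vspace chain} := (bd @: chains D q.+1)%VS.

(* The quotient cycles / boundaries, realised on the complement
   [cycles :\: boundaries]; [hclass] sends a cycle to its homology class
   ([hclass_mem], [hclass_id], [hclass_eq0]). *)
Definition homology D q : {vspace chain} := (cycles D q :\: boundaries D q)%VS.

Definition hclass D q : 'End(chain) := addv_pi1 (cycles D q) (boundaries D q).

Lemma hclass_mem D q (c : chain) : hclass D q c \in homology D q.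
Proof. exact: memv_pi. Qed.

Lemma hclass_id D q (c : chain) : c \in homology D q -> hclass D q c = c.
Proof. by apply: daddv_pi_id; rewrite capv_diff. Qed.

Lemma hclass_eq0 D q (c : chain) :
  c \in cycles D q -> (hclass D q c == 0) = (c \in boundaries D q).
Proof.
move=> cZ; have cZB : c \in (cycles D q + boundaries D q)%VS.
  by rewrite -[c]addr0 memv_add ?mem0v.
apply/eqP/idP => [c0|cB]; have := addv_pi1_pi2 cZB.
  by rewrite -/(hclass D q) c0 add0r => <-; apply: memv_pi2.
by rewrite addv_pi2_id // => /(congr1 (fun x => x - c)); rewrite addrK subrr.
Qed.

(* The Mayer-Vietoris connecting map
   H_(q.+1)(D :|: E) -> H_q(D :&: E), [c] |-> [bd c'] for c = c' + c'' with
   c' on D and c'' on E; c' is chosen to be the restriction of c to D, and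
   [mv_connectE] shows that this choice is immaterial. *)
Definition mv_connect D E q : 'End(chain) :=
  (hclass (D :&: E) q \o (bd \o restr D))%VF.

Lemma chainsP D q (c : chain) :
  reflect (forall F, c F != 0 -> F \in D /\ #|F| = q) (c \in chains D q).
Proof.
rewrite /chains; set s := map _ _; apply: (iffP idP) => [cD F|sup].
  rewrite (coord_span (X := in_tuple s) cD) sum_ffunE => cF.
  have [i] : exists i : 'I_(size s), (s`_i : chain) F != 0.
    apply/existsP; apply: contraNT cF => /existsPn nF.
    by rewrite big1 // => i _; rewrite ffunE (eqP (negbNE (nF i))) scaler0.
  have /mapP[G] := mem_nth 0 (ltn_ord i).
  rewrite mem_filter mem_enum => /andP[/eqP Gq GD] ->.
  by rewrite ffunE; case: (F =P G) => [-> //|_]; rewrite eqxx.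
have -> : c = \sum_(F | c F != 0) c F *: simplex F.
  apply/ffunP=> G; rewrite sum_ffunE.
  have [G0|Gn0] := eqVneq (c G) 0.
    rewrite G0 big1 // => F nF; rewrite !ffunE; case: eqP => [GF|_].
      by rewrite -GF G0 eqxx in nF.
    by rewrite scaler0.
  rewrite (bigD1 G) //= big1 ?addr0 => [|F /andP[_ FG]].
    by rewrite !ffunE eqxx /GRing.scale /= mulr1.
  by rewrite !ffunE eq_sym (negPf FG) scaler0.
apply: memv_suml => F /sup[FD Fq]; apply/memvZ/memv_span/mapP.
by exists F; rewrite // mem_filter mem_enum FD Fq eqxx.
Qed.

Lemma mv_connectE D E q (c' c'' : chain) :
  c' \in chains D q.+1 -> c'' \in chains E q.+1 ->
  c' + c'' \in cycles (D :|: E) q.+1 ->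
  mv_connect D E q (c' + c'') = hclass (D :&: E) q (bd c').
Proof.
move=> /chainsP c'D /chainsP c''E _; rewrite /mv_connect !comp_lfunE [restr _ _]lfunE /=.
have -> : restr_fun D (c' + c'') = c' + restr_fun D c''.
  apply/ffunP=> F; rewrite !ffunE; case: ifP => // nD.
  by rewrite addr0; case: (eqVneq (c' F) 0) => // /c'D[]; rewrite nD.
rewrite !linearD /= -[RHS]addr0; congr (_ + _).
set b := bd _; have bB : b \in boundaries (D :&: E) q.
  apply/memv_img/chainsP=> F; rewrite ffunE; case: ifP => [FD /c''E[FE ?]|].
    by rewrite inE FD FE.
  by rewrite eqxx.
have bZB : b \in (cycles (D :&: E) q + boundaries (D :&: E) q)%VS.
  by rewrite -[b]add0r memv_add ?mem0v.
have := addv_pi1_pi2 bZB; rewrite addv_pi2_id //.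
by move=> /(congr1 (fun x => x - b)); rewrite addrK subrr.
Qed.

End SimplicialHomology.

(** * The sequence C(P) of a finite poset with least element *)

Section PosetSequence.

Variables (k : fieldType) (disp : Order.disp_t) (P : finBPOrderType disp).
Local Notation chain := {ffun {set P} -> k^o}.
Implicit Types a b l : P.
Local Open Scope order_scope.

Definition covers l a := (l < a) && [forall b : P, ~~ ((l < b) && (b < a))].

(* all chains of (\bot, a], including the empty one *)
Definition Dcx a : {set {set P}} :=
  [set c : {set P} | [forall x in c, (\bot < x) && (x <= a)]
                     && [forall x in c, forall y in c, x >=< y]].

Definition Delta a : {set {set P}} := \bigcup_(l | covers l a) Dcx l.

Definition Dother a l : {set {set P}} :=
  \bigcup_(b | covers b a && (b != l)) Dcx b.

Definition Delta2 a l : {set {set P}} := Dcx l :&: Dother a l.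

Definition C0 : {vspace chain} := homology k [set set0] 0.

(* [Cpos j a] is C_(i,a) for i = j + 1: the reduced homology of [Delta a] in
   dimension i - 2 = j - 1. *)
Definition Cpos j a : {vspace chain} := homology k (Delta a) j.

(* For an atom a, [Delta a] is [[set set0]] and [phi1] is the identity of
   C0 = Cpos 0 a; for any other a > \bot, Cpos 0 a = 0. *)
Definition phi1 : 'End(chain) := hclass k [set set0] 0.

(* [phi j a l] is phi_i^(a,l) : C_(i,a) -> C_(i-1,l) for i = j + 2. *)
Definition phi j a l : 'End(chain) :=
  (hclass k (Delta l) j \o mv_connect k (Dcx l) (Dother a l) j)%VF.

End PosetSequence.

(** * Multigraded sequences of free modules over k[x_1, ..., x_n] *)

Section Multigraded.

Variables (k : fieldType) (n : nat).
Local Notation R := {mpoly k[n]}.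

Local Notation zdegree := {ffun 'I_n -> int}.

Definition zdeg (u : 'X_{1..n}) : zdegree := [ffun i => (u i)%:Z].

(* F_i is the free module on [gen i], i.e. the direct sum of the R(-gdeg e);
   the differential sends e in [gen i.+1] to
   \sum_(e' : gen i) entry e e' e'. *)
Record mgseq := MGSeq {
  gen : nat -> finType;
  gdeg : forall i, gen i -> zdegree;
  entry : forall i, gen i.+1 -> gen i -> R
}.

Definition mgmod (F : mgseq) (i : nat) := {ffun gen F i -> R}.

Definition mgdiff (F : mgseq) i (f : mgmod F i.+1) : mgmod F i :=
  [ffun e' => \sum_e f e * entry e e'].

(* f is homogeneous of degree d in F_i *)
Definition mghomog (F : mgseq) i (d : zdegree) (f : mgmod F i) :=
  forall e u, u \in msupp (f e) -> d = gdeg e + zdeg u.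

(* For an ideal N, a degree-0 homomorphism F_0 -> R/N is given by homogeneous
   representatives [aug e] of the images of the generators, and identities in
   R/N are congruences modulo N.  The maximal ideal (x_1, ..., x_n) consists
   of the polynomials without constant term. *)
Definition minimal_free_resolution (N : R -> Prop) (F : mgseq) : Prop :=
  [/\ (forall i (e : gen F i.+1) (e' : gen F i) u,
        u \in msupp (entry e e') -> gdeg e = gdeg e' + zdeg u),
      (forall i (f : mgmod F i.+1),
        mgdiff f = [ffun=> 0] <-> exists g : mgmod F i.+2, f = mgdiff g),
      (exists aug : gen F 0 -> R,
        [/\ forall e u, u \in msupp (aug e) -> gdeg e = zdeg u,
            forall p : R, exists f : mgmod F 0, N (p - \sum_e f e * aug e)
          & forall f : mgmod F 0, N (\sum_e f e * aug e) <->
              exists g : mgmod F 1, f = mgdiff g])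
    & (forall i (e : gen F i.+1) (e' : gen F i), (entry e e')@_0%MM = 0)].

Record mgbasis (F : mgseq) (i : nat) := MGBasis {
  bidx : finType;
  bvec : bidx -> mgmod F i;
  bdeg : bidx -> zdegree;
  bhomog : forall v, mghomog (bdeg v) (bvec v);
  bbasis : forall f : mgmod F i,
    exists! c : {ffun bidx -> R}, f = [ffun e => \sum_v c v * bvec v e]
}.

End Multigraded.

(** * Monomial ideals *)

Section MonomialIdeal.

Variables (n r : nat) (m : 'I_r -> 'X_{1..n}).
Implicit Types I J : {set 'I_r}.

Definition minimal_generators := forall i j, (m i <= m j)%MM -> i = j.

Definition mlcms I : 'X_{1..n} := \big[@mlcm n/0%MM]_(i in I) m i.

Definition scarf : {set {set 'I_r}} :=
  [set I | [forall J : {set 'I_r}, (J != I) ==> (mlcms I != mlcms J)]].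

Definition in_lcm (u : 'X_{1..n}) := [exists I, u == mlcms I].

Definition lcm_covers (u v : 'X_{1..n}) : Prop :=
  [/\ in_lcm u, in_lcm v, (u < v)%MM
    & forall w, in_lcm w -> ~~ ((u < w)%MM && (w < v)%MM)].

Section Ideal.

Variable k : fieldType.
Local Notation R := {mpoly k[n]}.

Definition monideal (p : R) : Prop :=
  exists c : 'I_r -> R, p = \sum_i c i * 'X_[m i].

Definition proper_monideal := ~ monideal 1.

Definition scarf_gen (i : nat) : finType :=
  {I : {set 'I_r} | (I \in scarf) && (#|I| == i)}.

Definition scarf_deg i (I : scarf_gen i) := zdeg (mlcms (val I)).

(* #|{y in I | y < x}| is j - 1 when x is the j-th element of I *)
Definition scarf_entry i (I : scarf_gen i.+1) (J : scarf_gen i) : R :=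
  \sum_(x in val I | val J == val I :\ x)
    (-1) ^+ #|[set y in val I | (y < x)%N]| *: 'X_[mlcms (val I) - mlcms (val J)].

Definition scarf_seq : mgseq k n := MGSeq scarf_deg scarf_entry.

Definition scarf_ideal := minimal_free_resolution monideal scarf_seq.

(* Stated for every minimal multigraded free resolution F of R/N; any two of
   them are isomorphic.  Only the coefficients [c] of the differential in the
   bases B matter, and those are unique by [bbasis]. *)
Definition lattice_linear := forall F : mgseq k n,
  minimal_free_resolution monideal F ->
  exists B : forall i, mgbasis F i,
    forall i (v : bidx (B i.+1)) (c : {ffun bidx (B i) -> R}),
      mgdiff (bvec v) = [ffun e => \sum_v' c v' * bvec v' e] ->
      forall v', c v' != 0 ->
        exists l a, [/\ bdeg v' = zdeg l, bdeg v = zdeg a & lcm_covers l a].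

Lemma mlcms_ge I i : i \in I -> (m i <= mlcms I)%MM.
Proof.
move=> iI; rewrite /mlcms; have := mem_index_enum i.
elim: (index_enum _) => [|j s IHs]; rewrite ?inE // big_cons.
case/orP=> [/eqP<-|/IHs/mnm_lepP le].
  by rewrite iI; apply/mnm_lepP=> x; rewrite mnmE leq_maxl.
by case: ifP => _; apply/mnm_lepP=> x; rewrite ?mnmE ?leq_max le ?orbT.
Qed.

Lemma mlcms_le I J : I \subset J -> (mlcms I <= mlcms J)%MM.
Proof.
move=> /subsetP IJ; apply: (big_ind (fun u => (u <= mlcms J)%MM)) => [|u v|].
- by apply/mnm_lepP=> x; rewrite mnm0E.
- move=> /mnm_lepP hu /mnm_lepP hv; apply/mnm_lepP=> x.
  by rewrite mnmE geq_max hu hv.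
- by move=> i /IJ /mlcms_ge.
Qed.

Lemma scarf0 : proper_monideal -> set0 \in scarf.
Proof.
move=> Nprop; rewrite inE; apply/forallP=> J; apply/implyP=> Jn0.
have [i iJ] := set0Pn _ Jn0; apply/eqP; rewrite {1}/mlcms big_set0 => J0.
apply: Nprop; exists (fun j => (j == i)%:R); rewrite (bigD1 i) //= big1.
  suff -> : m i = 0%MM by rewrite eqxx mpolyX0 mulr1 addr0.
  have /mnm_lepP le := mlcms_ge iJ; apply/mnmP=> x; rewrite mnm0E.
  by have := le x; rewrite -J0 mnm0E leqn0 => /eqP.
by move=> j /negPf ->; rewrite mul0r.
Qed.

End Ideal.

(* The face poset of the Scarf complex; the proof makes the empty face
   available as its least element. *)
Definition scarf_poset (h0 : set0 \in scarf) := {I : {set 'I_r} | I \in scarf}.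

Section FacePoset.

Variable h0 : set0 \in scarf.

HB.instance Definition _ := SubType.on (scarf_poset h0).
HB.instance Definition _ := Finite.on (scarf_poset h0).

Definition face_le (a b : scarf_poset h0) := val a \subset val b.

Lemma face_le_refl : reflexive face_le.
Proof. by move=> a; apply: subxx. Qed.
Lemma face_le_anti : antisymmetric face_le.
Proof. by move=> a b; rewrite /face_le -eqEsubset => /eqP/val_inj. Qed.
Lemma face_le_trans : transitive face_le.
Proof. by move=> b a c; apply: subset_trans. Qed.
HB.instance Definition _ := Order.Le_isPOrder.Build
  Order.SetSubsetOrder.subset_display (scarf_poset h0)
  face_le_refl face_le_anti face_le_trans.

Lemma scarf_poset_le (a b : scarf_poset h0) :
  (a <= b)%O = (val a \subset val b).
Proof. by []. Qed.

Definition empty_face : scarf_poset h0 := exist _ set0 h0.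

Lemma empty_face_least (a : scarf_poset h0) : (empty_face <= a)%O.
Proof. by rewrite scarf_poset_le sub0set. Qed.
HB.instance Definition _ :=
  Order.hasBottom.Build Order.SetSubsetOrder.subset_display (scarf_poset h0) empty_face_least.

Definition scarf_eta (a : scarf_poset h0) : 'X_{1..n} := mlcms (val a).

Lemma scarf_eta_homo (a b : scarf_poset h0) :
  (a <= b)%O -> (scarf_eta a <= scarf_eta b)%MM.
Proof. by rewrite scarf_poset_le => /mlcms_le. Qed.

End FacePoset.

End MonomialIdeal.

(** * The sequence F(eta)

   [eta] is meant to be a map of posets, so that [eta a - eta l] is not
   truncated.  The free module R (x) C is given by the basis 1 (x) b, for b in
   [vbasis C], and R (x) f by the matrix of f in these bases. *)

Section EtaSequence.

Variables (k : fieldType) (n : nat) (disp : Order.disp_t).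
Variables (P : finBPOrderType disp) (eta : P -> 'X_{1..n}).

Definition eta_gen (i : nat) : finType :=
  if i is j.+1 then
    {a : {a : P | a != \bot%O} & 'I_(\dim (Cpos k j (val a)))}
  else 'I_(\dim (C0 k P)).

Definition eta_deg (i : nat) : eta_gen i -> {ffun 'I_n -> int} :=
  if i is j.+1 then fun e => zdeg (eta (val (tag e))) else fun=> 0.

Definition eta_entry (i : nat) : eta_gen i.+1 -> eta_gen i -> {mpoly k[n]} :=
  match i return eta_gen i.+1 -> eta_gen i -> {mpoly k[n]} with
  | 0 => fun e e' =>
      coord (vbasis (C0 k P)) e' (phi1 k P (vbasis (Cpos k 0 (val (tag e))))`_(tagged e))
        *: 'X_[eta (val (tag e))]
  | j.+1 => fun e e' =>
      let a := val (tag e) in let l := val (tag e') in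
      if covers l a then
        coord (vbasis (Cpos k j l)) (tagged e')
              (phi k j a l (vbasis (Cpos k j.+1 a))`_(tagged e))
          *: 'X_[eta a - eta l]
      else 0
  end.

Definition eta_seq : mgseq k n := MGSeq eta_deg eta_entry.

End EtaSequence.

(* Main.v *)
From HB Require Import structures.
Require Import Defs.
From mathcomp Require Import all_boot all_order all_algebra ring.
From mathcomp.multinomials Require Import mpoly.
From Stdlib Require Import IndefiniteDescription.

(** Any two minimal multigraded free resolutions of R/N are isomorphic, because
   a homogeneous endomorphism of degree 0 that is the identity modulo
   (x_1, ..., x_n) is unitriangular for the total degree.  So the basis of the
   Scarf resolution can be carried over to every F; its differential runs
   through facets I \ x of faces I of the Scarf complex, and m_(I \ x) is
   covered by m_I since m_i | m_I forces i \in I.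

   For F(eta), Delta_I is the barycentric subdivision of the boundary of the
   simplex I, hence a homology sphere of dimension |I| - 2: removing the
   coatom I \ x leaves an acyclic complex, and the link of I \ x is
   Delta_(I \ x).  Let w_J be the subdivided simplex J and z_I the subdivided
   boundary of I.  Then z_I = \sum_x +-w_(I \ x) and bd w_J = z_J, so the
   Mayer-Vietoris map for the facet I \ x sends [z_I] to +-[z_(I \ x)] with
   exactly the sign of the simplicial boundary.  In the bases [z_I], F(eta) is
   therefore the Scarf resolution. *)

Set Implicit Arguments.
Unset Strict Implicit.
Unset Printing Implicit Defensive.

Import Order.Theory GRing.Theory Num.Theory.
Local Open Scope ring_scope.

(** * Homogeneous parts and homogeneous matrices over the polynomial ring *)

Section GradedFreeModules.

Variables (k : fieldType) (n : nat).
Local Notation R := {mpoly k[n]}.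
Local Notation zdegree := {ffun 'I_n -> int}.

Definition hpart (d : zdegree) (p : R) : R :=
  \sum_(u <- msupp p | zdeg u == d) p@_u *: 'X_[u].

Lemma mcoeff_hpart d p u : (hpart d p)@_u = if zdeg u == d then p@_u else 0.
Proof.
rewrite /hpart linear_sum /= big_mkcond /=.
have [up|] := boolP (u \in msupp p); last first.
  rewrite -mcoeff_eq0 => /eqP pu; rewrite pu if_same big1 // => v _.
  case: ifP => // _; rewrite mcoeffZ mcoeffX.
  by case: (v =P u) => [->|_]; rewrite ?pu ?mul0r ?mulr0.
rewrite (bigD1_seq u) ?msupp_uniq //= big1 ?addr0 => [|v /negPf vu].
  by case: ifP => // _; rewrite mcoeffZ mcoeffX eqxx mulr1.
by case: ifP => // _; rewrite mcoeffZ mcoeffX vu mulr0.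
Qed.

Lemma hpart_sum d (I : Type) (s : seq I) (P : pred I) (F : I -> R) :
  hpart d (\sum_(i <- s | P i) F i) = \sum_(i <- s | P i) hpart d (F i).
Proof.
apply/mpolyP=> u; rewrite mcoeff_hpart !linear_sum /=.
under [RHS]eq_bigr do rewrite mcoeff_hpart.
by case: ifP => // _; rewrite big1.
Qed.

Definition phomog (d : zdegree) (p : R) := forall u, u \in msupp p -> zdeg u = d.

Lemma hpart_id d p : phomog d p -> hpart d p = p.
Proof.
move=> hp; apply/mpolyP=> u; rewrite mcoeff_hpart.
by case: eqP => // du; apply/esym/eqP; rewrite mcoeff_eq0; apply/negP=> /hp.
Qed.

Lemma phomog_hpart d p : phomog d (hpart d p).
Proof. by move=> u; rewrite mcoeff_msupp mcoeff_hpart; case: (zdeg u =P d); rewrite ?eqxx. Qed.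

Lemma zdegD (u v : 'X_{1..n}) : zdeg (u + v)%MM = zdeg u + zdeg v.
Proof. by apply/ffunP=> i; rewrite !ffunE mnmDE PoszD. Qed.

(** A term of the convolution for the coefficient at [u] survives only if its second factor has
    degree [e]; its first factor then has degree [d] exactly when [u] has degree [d + e]. *)
Lemma hpartM d e p q : phomog e q -> hpart (d + e) (p * q) = hpart d p * q.
Proof.
move=> hq; apply/mpolyP=> u; rewrite mcoeff_hpart.
have lu : (mdeg u < (mdeg u).+1)%N by [].
rewrite !(mcoeff_poly_mul _ _ lu).
have E v : (u == (v.1 + v.2)%MM) -> q@_(v.2) != 0 ->
    (zdeg v.1 == d) = (zdeg u == d + e).
  move=> /eqP ->; rewrite -mcoeff_msupp => /hq.
  by rewrite zdegD => ->; rewrite (inj_eq (addIr e)).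
case: ifP => du; last rewrite big1 //; [apply: eq_bigr|] => v uv;
  rewrite mcoeff_hpart; have := E (val v.1, val v.2) uv;
  have [->|q0] := eqVneq (q@_(v.2)) 0; rewrite ?mulr0 // => ->;
  by rewrite // du // mul0r.
Qed.

Section Apply.

Variables (X Y : finType).
Implicit Types (M : X -> Y -> R) (f : {ffun X -> R}).

(** Vectors are rows and matrices act on the right, so that [app] of [entry] is convertible to
    [mgdiff]. *)
Definition app M f : {ffun Y -> R} := [ffun y => \sum_x f x * M x y].

Definition homog_vec (dX : X -> zdegree) d f :=
  forall x u, u \in msupp (f x) -> d = dX x + zdeg u.

Definition homog_mx (dX : X -> zdegree) (dY : Y -> zdegree) M :=
  forall x y u, u \in msupp (M x y) -> dX x = dY y + zdeg u.

Lemma app_is_additive M : additive (app M).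
Proof.
move=> f g; apply/ffunP=> y; rewrite !ffunE -sumrB; apply: eq_bigr => x _.
by rewrite !ffunE mulrBl.
Qed.
HB.instance Definition _ M :=
  GRing.isZmodMorphism.Build _ _ (app M) (app_is_additive M).

Definition unit_vec (x : X) : {ffun X -> R} := [ffun y => (y == x)%:R].

Lemma app_unit M x : app M (unit_vec x) = [ffun y => M x y].
Proof.
apply/ffunP=> y; rewrite !ffunE (bigD1 x) //= big1 ?addr0 => [|z /negPf zx].
  by rewrite !ffunE eqxx mul1r.
by rewrite !ffunE zx mul0r.
Qed.

(** Degrees are integral, so [d - dX x] is a true difference; when it has a negative coordinate, the
    part is 0. *)
Definition vpart dX (d : zdegree) f : {ffun X -> R} :=
  [ffun x => hpart (d - dX x) (f x)].

Lemma vpart_homog dX d f : homog_vec dX d (vpart dX d f).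
Proof. by move=> x u; rewrite ffunE => /phomog_hpart ->; rewrite addrC subrK. Qed.

Lemma vpart_id dX d f : homog_vec dX d f -> vpart dX d f = f.
Proof.
move=> hf; apply/ffunP=> x; rewrite ffunE hpart_id // => u /hf ->.
by rewrite addrC addKr.
Qed.

End Apply.

Lemma vpart_app (X Y : finType) dX dY (M : X -> Y -> R) d f :
  homog_mx dX dY M -> vpart dY d (app M f) = app M (vpart dX d f).
Proof.
move=> hM; apply/ffunP=> y; rewrite !ffunE hpart_sum; apply: eq_bigr => x _.
rewrite ffunE -(@hpartM _ (dX x - dY y)); first by rewrite addrA subrK.
by move=> u /hM ->; rewrite addrC addKr.
Qed.

(** The part of degree [d] of any preimage is again a preimage, because a homogeneous matrix
    commutes with taking parts. *)
Lemma homog_lift (X Y : finType) dX dY (M : X -> Y -> R) d g f :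
  homog_mx dX dY M -> homog_vec dY d g -> g = app M f ->
  exists2 f', homog_vec dX d f' & g = app M f'.
Proof.
move=> hM hg gf; exists (vpart dX d f); first exact: vpart_homog.
by rewrite -(vpart_app _ _ hM) -gf vpart_id.
Qed.

Lemma homog_app (X Y : finType) dX dY (M : X -> Y -> R) d f :
  homog_mx dX dY M -> homog_vec dX d f -> homog_vec dY d (app M f).
Proof. by move=> hM /vpart_id <-; rewrite -(vpart_app _ _ hM); apply: vpart_homog. Qed.

Definition tot (d : zdegree) : int := \sum_i d i.

Lemma tot_zdeg d u : u != 0%MM -> tot d < tot (d + zdeg u).
Proof.
move=> u0; have -> : tot (d + zdeg u) = tot d + (mdeg u)%:Z.
  rewrite /tot mdegE -[X in _ = _ + X]/(Posz _) (big_morph Posz PoszD (erefl _)) -big_split.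
  by apply: eq_bigr => i _; rewrite !ffunE.
by rewrite ltrDl ltz_nat lt0n mdeg_eq0.
Qed.

Definition no_const (X : finType) (f : {ffun X -> R}) := forall x, (f x)@_0%MM = 0.

Lemma no_const_app (X Y : finType) (M : X -> Y -> R) f :
  (forall x y, (M x y)@_0%MM = 0) -> no_const (app M f).
Proof.
move=> hM y; rewrite ffunE linear_sum big1 // => x _.
by rewrite /= rmorphM /= hM mulr0.
Qed.

(** * Homogeneous endomorphisms that are the identity modulo the variables *)

Section Unipotent.

Variables (X : finType) (dX : X -> zdegree) (M : X -> X -> R).
Hypothesis hM : homog_mx dX dX M.
Hypothesis M1 : forall x, no_const (app M (unit_vec x) - unit_vec x).

Let N x y := M x y - (y == x)%:R.

(** A nonzero entry without constant term contains a nontrivial monomial, whose degree is by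
    homogeneity the difference of the two generator degrees. *)
Lemma unipotent_lt x y : N x y != 0 -> tot (dX y) < tot (dX x).
Proof.
have N0 : (N x y)@_0%MM = 0 by have := M1 x y; rewrite app_unit !ffunE.
rewrite -msupp_eq0; case E: (msupp _) => [|u s] // _.
have uN : u \in msupp (N x y) by rewrite E mem_head.
have u0 : u != 0%MM.
  by apply: contraTneq uN => ->; rewrite mcoeff_msupp N0 eqxx.
suff -> : dX x = dX y + zdeg u by apply: tot_zdeg.
have := msuppB_le uN; rewrite mem_cat => /orP[/hM //|].
by case: (y == x); rewrite ?msupp1 ?msupp0 // inE (negPf u0).
Qed.

Let appN f y : app M f y = f y + \sum_x f x * N x y.
Proof.
have -> : f y = \sum_x f x * (y == x)%:R.
  rewrite (bigD1 y) //= eqxx mulr1 big1 ?addr0 // => x /negPf xy.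
  by rewrite eq_sym xy mulr0.
rewrite ffunE -big_split; apply: eq_bigr => x _.
by rewrite /= -mulrDr addrC subrK.
Qed.

Lemma unipotent_inj f : app M f = 0 -> f = 0.
Proof.
move=> Mf0; apply/ffunP=> y0; rewrite [RHS]ffunE; apply/eqP/negPn/negP=> fy0.
(* At a coordinate [y] of maximal total degree in the support of [f], the off-diagonal contributions
   would come from larger total degree, where [f] vanishes. *)
have [y fy ymax] := @Order.TotalTheory.arg_maxP _ _ X y0
  (fun x => f x != 0) (fun x => tot (dX x)) fy0.
have /ffunP/(_ y) := Mf0; rewrite [RHS]ffunE appN big1 ?addr0 => [/eqP|x _].
  by rewrite (negPf fy).
have [->|fx] := eqVneq (f x) 0; first by rewrite mul0r.
have [->|/unipotent_lt] := eqVneq (N x y) 0; first by rewrite mulr0.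
by rewrite ltNge; have := ymax x fx; rewrite /= => ->.
Qed.

Let scale (p : R) (f : {ffun X -> R}) : {ffun X -> R} := [ffun x => p * f x].

Let app_scale p f : app M (scale p f) = scale p (app M f).
Proof.
apply/ffunP=> y; rewrite !ffunE big_distrr; apply: eq_bigr => x _.
by rewrite ffunE /= mulrA.
Qed.

Let vec_expand (f : {ffun X -> R}) : f = \sum_x scale (f x) (unit_vec x).
Proof.
apply/ffunP=> y; rewrite sum_ffunE (bigD1 y) //= big1 => [|x /negPf xy].
  by rewrite !ffunE eqxx mulr1 addr0.
by rewrite !ffunE eq_sym xy mulr0.
Qed.

Lemma unipotent_surj g : exists f, app M f = g.
Proof.
pose im h := exists f, app M f = h.
have imD h h' : im h -> im h' -> im (h + h').
  by move=> [f <-] [f' <-]; exists (f + f'); rewrite raddfD.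
have imN h : im h -> im (- h) by move=> [f <-]; exists (- f); rewrite raddfN.
have imZ p h : im h -> im (scale p h).
  by move=> [f <-]; exists (scale p f); rewrite app_scale.
have im_sum (c : X -> R) : (forall x, c x != 0 -> im (unit_vec x)) ->
    im (\sum_x scale (c x) (unit_vec x)).
  move=> hc; apply: (big_ind im) => //; first by exists 0; rewrite raddf0.
  move=> x _; have [->|/hc/imZ //] := eqVneq (c x) 0.
  by exists 0; rewrite raddf0; apply/ffunP=> y; rewrite !ffunE mul0r.
rewrite [g]vec_expand; apply: (im_sum) => x _.
(* Induction on the number of generators of smaller total degree: the error
   [app M (unit_vec x) - unit_vec x] involves only such generators. *)
have [N0] := ubnP #|[pred y | tot (dX y) < tot (dX x)]|; elim: N0 x => // N0 IH x.
rewrite ltnS => leN.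
have -> : unit_vec x = app M (unit_vec x) -  \sum_y scale (N x y) (unit_vec y).
  rewrite app_unit; apply/ffunP=> y; rewrite !ffunE sum_ffunE (bigD1 y) //= big1.
    by rewrite !ffunE eqxx mulr1 addr0 opprB addrC subrK.
  by move=> z /negPf zy; rewrite !ffunE eq_sym zy mulr0.
apply: imD; first by exists (unit_vec x).
apply/imN/im_sum => y /unipotent_lt yx; apply: IH; apply: leq_trans leN.
apply/proper_card/properP; split.
  by apply/subsetP=> z; rewrite !inE => /lt_trans; apply.
by exists y; rewrite !inE // ltxx.
Qed.

End Unipotent.

Lemma app_app (X Y Z : finType) (A : X -> Y -> R) (B : Y -> Z -> R) f :
  app (fun x z => \sum_y A x y * B y z) f = app B (app A f).
Proof.
apply/ffunP=> z; rewrite !ffunE.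
under eq_bigr do rewrite big_distrr /=.
rewrite exchange_big; apply: eq_bigr => y _ /=.
by rewrite ffunE big_distrl; apply: eq_bigr => x _; rewrite mulrA.
Qed.

Lemma homog_comp (X Y Z : finType) dX dY dZ (A : X -> Y -> R) (B : Y -> Z -> R) :
  homog_mx dX dY A -> homog_mx dY dZ B ->
  homog_mx dX dZ (fun x z => \sum_y A x y * B y z).
Proof.
move=> hA hB x z u uAB.
have hx : homog_vec dY (dX x) [ffun y => A x y] by move=> y v; rewrite ffunE => /hA.
apply: (homog_app hB hx (x := z)); rewrite ffunE.
by under eq_bigr do rewrite ffunE.
Qed.

(** Both composites are unipotent: injectivity of one gives injectivity of [A], and surjectivity of
    the other gives surjectivity of [A]. *)
Lemma app_bijective (X Y : finType) dX dY (A : X -> Y -> R) (B : Y -> X -> R) :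
  homog_mx dX dY A -> homog_mx dY dX B ->
  (forall x, no_const (app B (app A (unit_vec x)) - unit_vec x)) ->
  (forall y, no_const (app A (app B (unit_vec y)) - unit_vec y)) ->
  injective (app A) /\ forall g, exists f, app A f = g.
Proof.
move=> hA hB BA AB; split=> [f f' /eqP|g].
  rewrite -subr_eq0 -raddfB => /eqP Aff'; apply/eqP; rewrite -subr_eq0; apply/eqP.
  apply: (unipotent_inj (homog_comp hA hB)) => [x|].
    by rewrite app_app; apply: BA.
  by rewrite app_app Aff' raddf0.
have [|f <-] := unipotent_surj (homog_comp hB hA) _ g.
  by move=> y; rewrite app_app; apply: AB.
by exists (app B f); rewrite app_app.
Qed.

Lemma homog_unit (X : finType) dX (x : X) : homog_vec dX (dX x) (unit_vec x).
Proof.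
by move=> y u; rewrite ffunE; case: eqP => [->|_]; rewrite ?msupp0 // msupp1 inE
  => /eqP ->; apply/ffunP=> i; rewrite !ffunE mnm0E addr0.
Qed.

Lemma homog_rows (X Y : finType) dX dY (A : X -> Y -> R) :
  homog_mx dX dY A <-> forall x, homog_vec dY (dX x) (app A (unit_vec x)).
Proof.
split=> [hA x|h x y u uA]; first exact: (homog_app hA (@homog_unit X dX x)).
by apply: (h x y); rewrite app_unit ffunE.
Qed.

Lemma choose_mx (X Y : finType) (Q : X -> {ffun Y -> R} -> Prop) :
  (forall x, exists f, Q x f) -> exists A : X -> Y -> R,
    forall x, Q x (app A (unit_vec x)).
Proof.
move=> /functional_choice[h hQ]; exists (fun x y => h x y) => x.
by rewrite app_unit (_ : [ffun y => _] = h x) //; apply/ffunP=> y; rewrite ffunE.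
Qed.

End GradedFreeModules.

(** * Comparison of minimal multigraded resolutions *)

Section Comparison.

Variables (k : fieldType) (n r : nat) (m : 'I_r -> 'X_{1..n}).
Local Notation R := {mpoly k[n]}.
Local Notation N := (@monideal n r m k).

Lemma monideal0 : N 0.
Proof. by exists (fun=> 0); rewrite big1 // => i _; rewrite mul0r. Qed.

Lemma monidealD p q : N p -> N q -> N (p + q).
Proof.
move=> [c ->] [c' ->]; exists (fun i => c i + c' i); rewrite -big_split.
by apply: eq_bigr => i _; rewrite mulrDl.
Qed.

Lemma monidealM p q : N q -> N (p * q).
Proof.
move=> [c ->]; exists (fun i => p * c i); rewrite big_distrr.
by apply: eq_bigr => i _; rewrite /= mulrA.
Qed.

Lemma monidealB p q : N p -> N q -> N (p - q).
Proof. by move=> Np Nq; rewrite -mulN1r; apply/monidealD/monidealM. Qed.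

Lemma app_ext (X Y : finType) (M M' : X -> Y -> R) :
  (forall x, app M (unit_vec k n x) = app M' (unit_vec k n x)) ->
  app M =1 app M'.
Proof.
move=> MM' f; apply/ffunP=> y; rewrite !ffunE; apply: eq_bigr => x _.
by have /ffunP/(_ y) := MM' x; rewrite !app_unit !ffunE => ->.
Qed.

(** Adjoining the monomials [m i] as further source generators, in their own degrees, turns the
    congruence modulo [N] into an equation to which [homog_lift] applies. *)
Lemma homog_rel_lift (X : finType) (dX : X -> {ffun 'I_n -> int}) (a : X -> R) d p :
    (forall e u, u \in msupp (a e) -> dX e = zdeg u) -> phomog d p ->
    (exists f : {ffun X -> R}, N (p - \sum_e f e * a e)) ->
  exists2 f : {ffun X -> R}, homog_vec dX d f & N (p - \sum_e f e * a e).
Proof.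
move=> ha hp [f [c pfc]].
pose M (x : X + 'I_r) (_ : unit) : R :=
  match x with inl e => a e | inr i => 'X_[m i] end.
pose dM (x : X + 'I_r) := match x with inl e => dX e | inr i => zdeg (m i) end.
have hM : homog_mx dM (fun=> 0) M.
  case=> [e|i] [] u; rewrite add0r; first exact: ha.
  by rewrite msuppX inE => /eqP ->.
have hp' : homog_vec (fun=> 0) d [ffun _ : unit => p].
  by move=> [] u; rewrite ffunE add0r => /hp.
have appM (g : {ffun X + 'I_r -> R}) y :
    app M g y = \sum_e g (inl e) * a e + \sum_i g (inr i) * 'X_[m i].
  by rewrite ffunE big_sumType.
have [|g hg pg] := @homog_lift _ _ _ _ _ _ M _ _
    [ffun x => match x with inl e => f e | inr i => c i end] hM hp'.
  apply/ffunP=> y; rewrite appM ffunE -[LHS](subrK (\sum_e f e * a e)) pfc addrC.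
  by congr (_ + _); apply: eq_bigr => i _; rewrite ffunE.
exists [ffun e => g (inl e)] => [e u|]; first by rewrite ffunE => /hg.
exists (fun i => g (inr i)); move/ffunP/(_ tt): pg; rewrite appM ffunE => ->.
by under [X in _ - X]eq_bigr do rewrite ffunE; rewrite addrC addKr.
Qed.

(** Treats [R/N] as the term in position -1, so that exactness has the same form in position 0 as in
    the others. *)
Definition aug_cycle (F : mgseq k n) (aug : gen F 0 -> R) i : mgmod F i -> Prop :=
  match i with
  | 0 => fun f => N (\sum_e f e * aug e)
  | j.+1 => fun f => mgdiff f = 0
  end.

Variables F G : mgseq k n.

(** The invariant of the induction; matching the cycles on both sides is what allows lifting through
    the next differential. *)
Definition aug_iso (aF : gen F 0 -> R) (aG : gen G 0 -> R) i
    (A : gen F i -> gen G i -> R) : Prop :=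
  [/\ homog_mx (@gdeg _ _ F i) (@gdeg _ _ G i) A, injective (app A),
      forall g, exists f, app A f = g
    & forall f, aug_cycle aF f <-> aug_cycle aG (app A f)].

End Comparison.

Section ComparisonTheorem.

Variables (k : fieldType) (n r : nat) (m : 'I_r -> 'X_{1..n}).
Local Notation R := {mpoly k[n]}.
Local Notation N := (@monideal n r m k).

(** Cycles are boundaries by exactness, and by minimality the entries of the differential have no
    constant term. *)
Lemma aug_no_const (F : mgseq k n) aF i (f : mgmod F i) :
    minimal_free_resolution N F ->
    (forall f : mgmod F 0, N (\sum_e f e * aF e) <->
       exists g : mgmod F 1, f = mgdiff g) ->
  aug_cycle m aF f -> no_const f.
Proof.
move=> [_ exF _ minF] exF0 fZ.
have [g ->] : exists g : mgmod F i.+1, f = mgdiff g.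
  by case: i f fZ => [|i] f; [move/exF0|move/exF].
exact/no_const_app/minF.
Qed.

Lemma lift_base_map (F G : mgseq k n) (aF : gen F 0 -> R) (aG : gen G 0 -> R) :
    (forall e u, u \in msupp (aF e) -> gdeg e = zdeg u) ->
    (forall e u, u \in msupp (aG e) -> gdeg e = zdeg u) ->
    (forall p : R, exists f : mgmod G 0, N (p - \sum_e f e * aG e)) ->
  exists2 A : gen F 0 -> gen G 0 -> R, homog_mx (@gdeg _ _ F 0) (@gdeg _ _ G 0) A &
    forall f : mgmod F 0, N (\sum_e f e * aF e - \sum_e app A f e * aG e).
Proof.
move=> hF hG sG.
have [|A hA] := @choose_mx k n (gen F 0) (gen G 0) (fun x f =>
    homog_vec (@gdeg _ _ G 0) (gdeg x) f /\ N (aF x - \sum_e f e * aG e)).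
  move=> x.
  have px : phomog (gdeg x) (aF x) by move=> u /hF.
  by have [f hf Nf] := homog_rel_lift hG px (sG (aF x)); exists f.
exists A => [|f]; first by apply/homog_rows => x; have [] := hA x.
have -> : \sum_e f e * aF e - \sum_e app A f e * aG e =
    \sum_e f e * (aF e - \sum_e' A e e' * aG e').
  under [RHS]eq_bigr do rewrite mulrBr; rewrite sumrB; congr (_ - _).
  under [RHS]eq_bigr do rewrite big_distrr /=.
  rewrite exchange_big; apply: eq_bigr => e' _; rewrite ffunE big_distrl.
  by apply: eq_bigr => e _; rewrite /= mulrA.
apply: (big_ind N) => [||e _]; [exact: monideal0|exact: monidealD|].
apply: monidealM; have [_] := hA e; rewrite app_unit.
by under eq_bigr do rewrite ffunE.
Qed.

(** The identity of [R/N] lifts in both directions. A composite of the lifts minus the identity maps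
    into [N], so [aug_no_const] and [app_bijective] apply. *)
Lemma iso_base (F G : mgseq k n) aF aG :
    minimal_free_resolution N F -> minimal_free_resolution N G ->
    [/\ forall e u, u \in msupp (aF e) -> gdeg e = zdeg u,
        forall p : R, exists f : mgmod F 0, N (p - \sum_e f e * aF e)
      & forall f : mgmod F 0, N (\sum_e f e * aF e) <->
          exists g : mgmod F 1, f = mgdiff g] ->
    [/\ forall e u, u \in msupp (aG e) -> gdeg e = zdeg u,
        forall p : R, exists f : mgmod G 0, N (p - \sum_e f e * aG e)
      & forall f : mgmod G 0, N (\sum_e f e * aG e) <->
          exists g : mgmod G 1, f = mgdiff g] ->
  exists A : gen F 0 -> gen G 0 -> R, aug_iso m aF aG A.
Proof.
move=> mF mG [hF sF zF] [hG sG zG].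
have [A hA AN] := lift_base_map hF hG sG; have [B hB BN] := lift_base_map hG hF sF.
have diffE (K : mgseq k n) (a : gen K 0 -> R) f g :
    \sum_e (f - g : mgmod K 0) e * a e = \sum_e f e * a e - \sum_e g e * a e.
  by rewrite -sumrB; apply: eq_bigr => e _; rewrite !ffunE mulrBl.
have [||injA surjA] := app_bijective hA hB.
- move=> x; apply: (aug_no_const mF zF); rewrite /= diffE.
  rewrite -[X in X - _](subrK (\sum_e app A (unit_vec k n x) e * aG e)).
  rewrite -addrA; apply: monidealD; rewrite -opprB -sub0r; apply: monidealB => //;
  by first [exact: monideal0 | rewrite ?opprB; first [exact: AN | exact: BN]].
- move=> x; apply: (aug_no_const mG zG); rewrite /= diffE.
  rewrite -[X in X - _](subrK (\sum_e app B (unit_vec k n x) e * aF e)).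
  rewrite -addrA; apply: monidealD; rewrite -opprB -sub0r; apply: monidealB => //;
  by first [exact: monideal0 | rewrite ?opprB; first [exact: AN | exact: BN]].
exists A; split=> // f /=; split=> Nf.
  by rewrite -[X in N X](subKr (\sum_e f e * aF e)); apply: monidealB.
by rewrite -[X in N X](subrK (\sum_e app A f e * aG e)); apply: monidealD.
Qed.

(** [A'] lifts [A] after the differential of [F] through the differential of [G]; this is possible
    because [A] sends cycles to cycles, which are boundaries in [G]. *)
Lemma iso_step (F G : mgseq k n) aF aG i (A : gen F i -> gen G i -> R) :
    minimal_free_resolution N F -> minimal_free_resolution N G ->
    (forall f : mgmod F 0, N (\sum_e f e * aF e) <->
       exists g : mgmod F 1, f = mgdiff g) ->
    (forall f : mgmod G 0, N (\sum_e f e * aG e) <->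
       exists g : mgmod G 1, f = mgdiff g) ->
    aug_iso m aF aG A ->
  exists2 A' : gen F i.+1 -> gen G i.+1 -> R, aug_iso m aF aG A' &
    forall f, app (@entry _ _ G i) (app A' f) = app A (app (@entry _ _ F i) f).
Proof.
move=> mF mG zF zG [hA injA surjA cA].
have [hF exF _ _] := mF; have [hG exG _ _] := mG.
have cycF (f : mgmod F i) : aug_cycle m aF f <-> exists g : mgmod F i.+1, f = mgdiff g.
  by case: i f {A hA injA surjA cA} => [|i] f; [apply: zF|apply: exF].
have cycG (f : mgmod G i) : aug_cycle m aG f <-> exists g : mgmod G i.+1, f = mgdiff g.
  by case: i f {A hA injA surjA cA cycF} => [|i] f; [apply: zG|apply: exG].
have [|A' A'P] := @choose_mx k n (gen F i.+1) (gen G i.+1) (fun x f =>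
    homog_vec (@gdeg _ _ G i.+1) (gdeg x) f /\
    app (@entry _ _ G i) f = app A (app (@entry _ _ F i) (unit_vec k n x))).
  move=> x; have /cycG[g Eg] : aug_cycle m aG (app A (app (@entry _ _ F i) (unit_vec k n x))).
    by apply/cA/cycF; exists (unit_vec k n x).
  have h : homog_vec (@gdeg _ _ G i) (gdeg x) (app A (app (@entry _ _ F i) (unit_vec k n x))).
    by apply: homog_app hA _; apply: homog_app (hF i) _; apply: homog_unit.
  by have [g' hg' ->] := homog_lift (hG i) h Eg; exists g'.
have hA' : homog_mx (@gdeg _ _ F i.+1) (@gdeg _ _ G i.+1) A'.
  by apply/homog_rows => x; case: (A'P x).
have A'E f : app (@entry _ _ G i) (app A' f) = app A (app (@entry _ _ F i) f).
  rewrite -!app_app; apply: app_ext => x; rewrite !app_app.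
  by case: (A'P x).
(* The lift in the other direction is specified after applying [A], which avoids a matrix inverse of
   [A]; it is found by lifting along the homogeneous composite of the differential of [F] with
   [A]. *)
have [|B' B'P] := @choose_mx k n (gen G i.+1) (gen F i.+1) (fun x f =>
    homog_vec (@gdeg _ _ F i.+1) (gdeg x) f /\
    app A (app (@entry _ _ F i) f) = app (@entry _ _ G i) (unit_vec k n x)).
  move=> x; have : aug_cycle m aG (app (@entry _ _ G i) (unit_vec k n x)).
    by apply/cycG; exists (unit_vec k n x).
  have [f Ef] := surjA (app (@entry _ _ G i) (unit_vec k n x)).
  rewrite -Ef => /cA /cycF [g Eg].
  have Axg : app (@entry _ _ G i) (unit_vec k n x) =
      app (fun x z => \sum_y entry x y * A y z) g.
    by rewrite app_app -Ef Eg.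
  have h : homog_vec (@gdeg _ _ G i) (gdeg x) (app (@entry _ _ G i) (unit_vec k n x)).
    by apply: homog_app (hG i) _; apply: homog_unit.
  have [g' hg' Eg'] := homog_lift (homog_comp (hF i) hA) h Axg.
  by exists g'; split=> //; rewrite Ef Eg' app_app.
have hB' : homog_mx (@gdeg _ _ G i.+1) (@gdeg _ _ F i.+1) B'.
  by apply/homog_rows => x; case: (B'P x).
have B'E f : app A (app (@entry _ _ F i) (app B' f)) = app (@entry _ _ G i) f.
  rewrite -!app_app; apply: app_ext => x; rewrite !app_app.
  by case: (B'P x).
have [||injA' surjA'] := app_bijective hA' hB'.
- move=> x; apply: (aug_no_const mF zF).
  change (app (@entry _ _ F i) (app B' (app A' (unit_vec k n x)) - unit_vec k n x) = 0).
  by apply: injA; rewrite !raddfB /= B'E A'E subrr raddf0.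
- move=> x; apply: (aug_no_const mG zG).
  change (app (@entry _ _ G i) (app A' (app B' (unit_vec k n x)) - unit_vec k n x) = 0).
  by rewrite raddfB /= A'E B'E subrr.
exists A' => //; split=> // f.
change (app (@entry _ _ F i) f = 0 <-> app (@entry _ _ G i) (app A' f) = 0).
rewrite A'E; split=> [->|]; first by rewrite raddf0.
by rewrite -(raddf0 (app A)) => /injA.
Qed.

Theorem minimal_resolution_unique (F G : mgseq k n) :
    minimal_free_resolution N F -> minimal_free_resolution N G ->
  exists A : forall i, gen F i -> gen G i -> R,
    [/\ forall i, homog_mx (@gdeg _ _ F i) (@gdeg _ _ G i) (A i),
        forall i, injective (app (A i)),
        forall i g, exists f, app (A i) f = g
      & forall i f, app (@entry _ _ G i) (app (A i.+1) f) =
                    app (A i) (app (@entry _ _ F i) f)].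
Proof.
move=> mF mG; have [_ _ [aF PF] _] := mF; have [_ _ [aG PG] _] := mG.
have [_ _ zF] := PF; have [_ _ zG] := PG.
pose T i := {A : gen F i -> gen G i -> R | aug_iso m aF aG A}.
have [A0 A0P] := iso_base mF mG PF PG.
(* Each isomorphism depends on the one before it, so existence is turned into a function and the
   family is built by recursion. *)
have step i (A : T i) : {A' : T i.+1 |
    forall f, app (@entry _ _ G i) (app (sval A') f) = app (sval A) (app (@entry _ _ F i) f)}.
  apply: constructive_indefinite_description.
  have [A' A'P E] := iso_step mF mG zF zG (svalP A).
  by exists (exist _ A' A'P).
pose A := fix A i : T i :=
  if i is j.+1 return T i then sval (step j (A j)) else exist _ A0 A0P.
exists (fun i => sval (A i)); split=> i.
- by have [] := svalP (A i).
- by have [] := svalP (A i).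
- by have [] := svalP (A i).
- exact: (svalP (step i (A i))).
Qed.

End ComparisonTheorem.

(** * Combinatorics of Scarf faces in the lcm-lattice *)

Section ScarfFaces.

Variables (n r : nat) (m : 'I_r -> 'X_{1..n}).
Implicit Types I J : {set 'I_r}.

Lemma lem_anti (u v : 'X_{1..n}) : (u <= v)%MM -> (v <= u)%MM -> u = v.
Proof.
move=> /mnm_lepP uv /mnm_lepP vu; apply/mnmP=> i.
by apply/eqP; rewrite eqn_leq uv vu.
Qed.

Lemma mlcms_lub I u : (forall i, i \in I -> (m i <= u)%MM) -> (mlcms m I <= u)%MM.
Proof.
move=> mu; apply: (big_ind (fun v => (v <= u)%MM)) => [|v w vu wu|i /mu //].
  by apply/mnm_lepP=> x; rewrite mnm0E.
by rewrite lem_mlcm vu.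
Qed.

Lemma scarfP I : reflect (forall J, mlcms m J = mlcms m I -> J = I) (I \in scarf m).
Proof.
rewrite inE; apply: (iffP forallP) => [h J e|h J].
  by have := h J; rewrite e eqxx; case: eqP.
by apply/implyP; apply: contraNneq => /esym/h ->.
Qed.

(** Adjoining [i] to [I] would not change the lcm, and [I] is the only set with its lcm. *)
Lemma scarf_closed I i : I \in scarf m -> (m i <= mlcms m I)%MM -> i \in I.
Proof.
move=> /scarfP sI mi; rewrite -(sI (i |: I)) ?setU11 //; apply: lem_anti.
  by apply: mlcms_lub => j /setU1P[->//|/mlcms_ge].
by apply/mlcms_le/subsetUr.
Qed.

Lemma scarf_facet_not_le I i :
  I \in scarf m -> i \in I -> ~~ (m i <= mlcms m (I :\ i))%MM.
Proof.
move=> /scarfP sI iI; apply/negP=> mi; have /setP/(_ i) : I :\ i = I.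
  apply/sI/lem_anti; first exact/mlcms_le/subD1set.
  apply: mlcms_lub => j jI; have [->//|ji] := eqVneq j i.
  by apply: mlcms_ge; rewrite !inE ji.
by rewrite !inE eqxx iI.
Qed.

(** A set [J'] with the lcm of [J] lies in [I] by [scarf_closed]. An index [i] in only one of [J]
    and [J'] would have [m i] dividing the lcm of the other, hence that of [I :\ i], against
    [scarf_facet_not_le]. *)
Lemma scarf_subset I J : I \in scarf m -> J \subset I -> J \in scarf m.
Proof.
move=> sI JI; apply/scarfP => J' JJ'.
have J'I : J' \subset I.
  apply/subsetP=> i iJ'; apply: (scarf_closed sI).
  by apply: lepm_trans (mlcms_ge _ iJ') _; rewrite JJ'; apply: mlcms_le.
have sub K K' : mlcms m K = mlcms m K' -> K \subset I -> K' \subset I -> K \subset K'.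
  move=> E KI K'I; apply/subsetP=> i iK; have iI := subsetP KI _ iK.
  apply: contraNT (scarf_facet_not_le sI iI) => iK'.
  apply: lepm_trans (mlcms_ge _ iK) _; rewrite E; apply: mlcms_le.
  by rewrite subsetD1 K'I.
by apply/eqP; rewrite eqEsubset; apply/andP; split; apply: sub.
Qed.

(** An lcm of [J] between the two has [J] inside [I]. If [i] is in [J], it is divisible by all
    generators of [I] and is the upper end; otherwise [J] lies in [I :\ i] and it is the lower
    end. *)
Lemma lcm_covers_facet I i :
  I \in scarf m -> i \in I -> lcm_covers m (mlcms m (I :\ i)) (mlcms m I).
Proof.
move=> sI iI; have nle := scarf_facet_not_le sI iI.
split; try by apply/existsP; eexists; apply: eqxx.
  rewrite /ltm mlcms_le ?subD1set // andbT; apply: contraNneq nle => ->.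
  exact: mlcms_ge.
move=> w /existsP[J /eqP->]; apply/negP => /andP[/andP[J1 I1J] /andP[J2 JI]].
have JsI : J \subset I.
  apply/subsetP=> j /mlcms_ge mj; apply: (scarf_closed sI).
  exact: lepm_trans (mj _ _) JI.
have [iJ|iJ] := boolP (i \in J).
  case/eqP: J2; apply: lem_anti => //; apply: mlcms_lub => j jI.
  have [->|ji] := eqVneq j i; first exact: mlcms_ge.
  by apply: lepm_trans I1J; apply: mlcms_ge; rewrite !inE ji.
case/eqP: J1; apply: lem_anti => //; apply: mlcms_le.
by rewrite subsetD1 JsI.
Qed.

End ScarfFaces.

(** * Lattice-linearity of Scarf ideals *)

Lemma scarf_lattice_linear (k : fieldType) (n r : nat) (m : 'I_r -> 'X_{1..n}) :
  scarf_ideal m k -> lattice_linear m k.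
Proof.
move=> scN F mF; have [A [hA injA surjA comm]] := minimal_resolution_unique scN mF.
have h i v : mghomog (F := F) (scarf_deg v) (app (A i) (unit_vec k n v)).
  exact: (iffLR (homog_rows _ _ _) (hA i)).
have lin i (c : {ffun scarf_gen m i -> {mpoly k[n]}}) :
    [ffun e => \sum_v c v * app (A i) (unit_vec k n v) e] = app (A i) c.
  by apply/ffunP=> e; rewrite !ffunE; apply: eq_bigr => v _; rewrite app_unit ffunE.
have b i (f : mgmod F i) : exists! c : {ffun scarf_gen m i -> {mpoly k[n]}},
    f = [ffun e => \sum_v c v * app (A i) (unit_vec k n v) e].
  have [c Ac] := surjA i f; exists c; split; first by rewrite lin.
  by move=> c'; rewrite lin -Ac => /injA.
exists (fun i => MGBasis (h i) (b i)) => i v c /=; rewrite lin.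
(* By injectivity of [A i], the coefficients in the transported basis are exactly the entries of the
   Scarf differential. *)
rewrite -[mgdiff _]/(app (@entry _ _ F i) _) comm => /injA /esym ->.
move=> v'; rewrite app_unit ffunE /= /scarf_entry => nz.
have [x /andP[xv /eqP v'E]] : exists x, (x \in val v) && (val v' == val v :\ x).
  apply/existsP; apply: contraNT nz => /existsPn nx.
  by rewrite big_pred0 // => x; apply/negbTE.
exists (mlcms m (val v')), (mlcms m (val v)); split=> //.
by rewrite v'E; apply: lcm_covers_facet => //; have /andP[] := valP v.
Qed.

(** * Cones and links of simplicial chains *)

Section Cones.

Variables (k : fieldType) (T : finType).
Local Notation chain := {ffun {set T} -> k^o}.
Implicit Types (D E K : {set {set T}}) (F G : {set T}) (c g : chain) (v w : T).

(** Makes sense also for [v] outside [F], where it is the incidence sign of [F] in [v |: F]. *)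
Definition psign v F : k := (-1) ^+ #|[set w in F | (enum_rank w < enum_rank v)%N]|.

Lemma psign2 v F : psign v F * psign v F = 1.
Proof. by rewrite -expr2 sqrr_sign. Qed.

Lemma psignD1 v F : psign v (F :\ v) = psign v F.
Proof.
congr (_ ^+ _); apply: eq_card => w; rewrite !inE.
by case: (w =P v) => [->|]; rewrite ?ltnn ?andbF.
Qed.

Lemma psignU1 v w F : w \notin F ->
  psign v (w |: F) = (-1) ^+ (enum_rank w < enum_rank v)%N * psign v F.
Proof.
move=> wF; rewrite /psign -exprD; congr (_ ^+ _).
rewrite (cardsD1 w) !inE eqxx /=; congr (_ + _)%N.
by apply: eq_card => x; rewrite !inE; case: (x =P w) => [->|//]; rewrite (negPf wF).
Qed.

Lemma psign_swap v w F : v != w -> v \notin F -> w \notin F ->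
  psign w (v |: F) * psign v (w |: (v |: F)) = - (psign v (v |: F) * psign w F).
Proof.
move=> vw vF wF; rewrite !psignU1 ?(inE, negPf vF, negPf wF, eq_sym w, negPf vw) //.
rewrite ltnn mul1r; have : enum_rank v != enum_rank w :> nat.
  by apply: contraNneq vw => /ord_inj/enum_rank_inj ->.
by case: ltngtP => // _ _; rewrite ?expr1 ?expr0; ring.
Qed.

Lemma bdE c G : bd k T c G = \sum_(v | v \notin G) psign v G * c (v |: G).
Proof.
rewrite lfunE /= /bd_fun sum_ffunE.
transitivity (\sum_(F : {set T}) \sum_(v in F) c F * (psign v F * (G == F :\ v)%:R)).
  apply: eq_bigr => F _; rewrite ffunE /GRing.scale /= sum_ffunE big_distrr.
  by apply: eq_bigr => v _; rewrite !ffunE.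
rewrite (exchange_big_dep xpredT) //= [RHS]big_mkcond /=; apply: eq_bigr => v _.
case: ifP => vG; last first.
  rewrite big1 // => F vF; case: eqP => [GF|_]; last by rewrite !mulr0.
  by rewrite GF !inE eqxx in vG.
rewrite (bigD1 (v |: G)) ?setU11 //= setU1K // eqxx mulr1 big1 ?addr0.
  by rewrite -[in LHS]psignD1 setU1K // mulrC.
move=> F /andP[vF FG]; case: eqP => [GF|_]; last by rewrite !mulr0.
by rewrite GF setD1K ?eqxx in FG.
Qed.

(** The join with [v] placed as first vertex; the sign moves [v] to its place in the enumeration.
    [link v] extracts the factor of [v] under the same convention. *)
Definition cone v c : chain := [ffun F : {set T} => if v \in F then psign v F * c (F :\ v) else 0].

Definition link v c : chain := [ffun F : {set T} => if v \in F then 0 else psign v F * c (v |: F)].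

Definition avoids v c := forall F, v \in F -> c F = 0.

Lemma cone_is_additive v : additive (cone v).
Proof.
move=> c c'; apply/ffunP=> F; rewrite !ffunE.
by case: ifP; rewrite ?subr0 // mulrBr.
Qed.
HB.instance Definition _ v :=
  GRing.isZmodMorphism.Build _ _ (cone v) (cone_is_additive v).

Lemma link_is_linear v : linear (link v).
Proof.
move=> a c c'; apply/ffunP=> F; rewrite !ffunE.
case: ifP; rewrite ?scaler0 ?addr0 // => _.
by rewrite mulrDr /GRing.scale /= mulrCA.
Qed.
HB.instance Definition _ v := GRing.isLinear.Build k _ _ _ (link v) (link_is_linear v).

(** This holds even for chains with faces through [v]: at a face [G] containing [v], the term of
    [bd c] at [G :\ v] that adds [v] back cancels [c G]. *)
Lemma bd_cone v c : bd k T (cone v c) = c - cone v (bd k T c).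
Proof.
apply/ffunP=> G; rewrite bdE !ffunE.
case: ifPn => [vG|vG]; last first.
  rewrite oppr0 addr0 (bigD1 v) //= ffunE setU11 setU1K // -[psign v (_ |: _)]psignD1.
  rewrite setU1K // mulrA psign2 mul1r big1 ?addr0 // => w /andP[_ wv].
  by rewrite ffunE !inE eq_sym (negPf wv) (negPf vG) mulr0.
rewrite bdE [in RHS](bigD1 v) ?setD11 //= setD1K // mulrDr mulrA.
rewrite psignD1 psign2 mul1r opprD addrA subrr add0r big_distrr -sumrN.
apply: eq_big => [w|w wG].
  by rewrite !inE negb_and negbK; case: eqP => [->|]; rewrite ?vG ?andbT ?orbF.
have vw : v != w by apply: contraNneq wG => <-.
rewrite ffunE !inE vG orbT.
have wG' : w \notin G :\ v by rewrite !inE negb_and wG orbT.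
have vG' : v \notin G :\ v by rewrite setD11.
have := psign_swap vw vG' wG'; rewrite setD1K // => sw.
rewrite /= !mulrA sw mulNr; congr (- (_ * c _)).
by apply/setP=> x; rewrite !inE; case: (x =P v) => [->|_] //=; rewrite (negPf vw).
Qed.

Lemma link_decomp v c : exists2 c0, avoids v c0 & c = cone v (link v c) + c0.
Proof.
exists [ffun F : {set T} => if v \in F then 0 else c F]; first by move=> F vF; rewrite ffunE vF.
apply/ffunP=> F; rewrite !ffunE; case: ifP => vF; rewrite ?add0r ?addr0 //.
by rewrite setD11 setD1K // psignD1 mulrA psign2 mul1r.
Qed.

Lemma link_avoids v c : avoids v (link v c).
Proof. by move=> F vF; rewrite ffunE vF. Qed.

Lemma bd_avoids v c : avoids v c -> avoids v (bd k T c).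
Proof.
by move=> vc F vF; rewrite bdE big1 // => w _; rewrite vc ?mulr0 // !inE vF orbT.
Qed.

Lemma link_eq0 v c : avoids v c -> link v c = 0.
Proof.
move=> vc; apply/ffunP=> F; rewrite !ffunE; case: ifP => // _.
by rewrite vc ?mulr0 ?setU11.
Qed.

Lemma link_cone v c : avoids v c -> link v (cone v c) = c.
Proof.
move=> vc; apply/ffunP=> F; rewrite !ffunE; case: ifPn => vF; first by rewrite vc.
rewrite setU11 setU1K // -[psign v (_ |: _)]psignD1 setU1K //.
by rewrite mulrA psign2 mul1r.
Qed.

(** Apply [bd_cone] to the decomposition of [c] into a cone from [v] and a part avoiding [v], and
    read off the faces through [v]. *)
Lemma link_bd v c : link v (bd k T c) = - bd k T (link v c).
Proof.
have [c0 vc0 {1}->] := link_decomp v c.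
rewrite raddfD /= bd_cone raddfD /= [X in X + _]raddfB /=.
rewrite (link_eq0 (@link_avoids v c)) link_cone; last exact/bd_avoids/link_avoids.
by rewrite (link_eq0 (bd_avoids vc0)) addr0 sub0r.
Qed.

Lemma bd_simplexE F : bd k T (simplex k F) = bd_simplex k F.
Proof.
rewrite lfunE /= /bd_fun (bigD1 F) //= big1 ?addr0 => [|G /negPf GF].
  by rewrite ffunE eqxx scale1r.
by rewrite ffunE GF scale0r.
Qed.

Lemma chain_expand c : c = \sum_F c F *: simplex k F.
Proof.
apply/ffunP=> G; rewrite sum_ffunE (bigD1 G) //= big1 => [|F /negPf GF].
  by rewrite !ffunE eqxx addr0 /GRing.scale /= mulr1.
by rewrite !ffunE eq_sym GF scaler0.
Qed.

(** A nonempty simplex is up to sign the cone over one of its facets, so two uses of [bd_cone]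
    reduce the claim to that facet. *)
Lemma bd_bd c : bd k T (bd k T c) = 0.
Proof.
rewrite [c]chain_expand !linear_sum big1 // => F _; rewrite !linearZ /=.
suff -> : bd k T (bd k T (simplex k F)) = 0 by rewrite scaler0.
have [s] := ubnP #|F|; elim: s F => // s IH F; rewrite ltnS => Fs.
have [->|[v vF]] := set_0Vmem F.
  by rewrite bd_simplexE /bd_simplex big_set0 linear0.
have -> : simplex k F = psign v F *: cone v (simplex k (F :\ v)).
  apply/ffunP=> G; rewrite !ffunE; case: ifPn => vG; last first.
    case: eqP vF => [<-|_ _]; first by rewrite (negPf vG).
    by rewrite scaler0.
  rewrite (_ : (G :\ v == F :\ v) = (G == F)); last first.
    apply/eqP/eqP => [e|-> //]; by rewrite -(setD1K vG) e setD1K.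
  case: eqP => [->|_]; last by rewrite mulr0 scaler0.
  by rewrite mulr1 /GRing.scale /= psign2.
rewrite !linearZ /= bd_cone linearB /= bd_cone IH; last first.
  by apply: leq_trans Fs; rewrite (cardsD1 v F) vF.
by rewrite raddf0 subr0 subrr scaler0.
Qed.

Lemma cone_chains v D E q c : (forall F, F \in D -> v \notin F -> v |: F \in E) ->
  c \in chains k D q -> cone v c \in chains k E q.+1.
Proof.
move=> DE /chainsP cD; apply/chainsP => F; rewrite ffunE; case: ifP => [vF|]; last by rewrite eqxx.
rewrite mulf_eq0 negb_or => /andP[_ /cD[FD Fq]].
by rewrite -{1}(setD1K vF) DE ?setD11 // (cardsD1 v) vF Fq.
Qed.

Lemma link_chains v D E q c : (forall F, v |: F \in D -> v \notin F -> F \in E) ->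
  c \in chains k D q.+1 -> link v c \in chains k E q.
Proof.
move=> DE /chainsP cD; apply/chainsP => F; rewrite ffunE.
case: ifPn => [|vF]; first by rewrite eqxx.
rewrite mulf_eq0 negb_or => /andP[_ /cD[FD Fq]]; split; first exact: DE.
by move: Fq; rewrite cardsU1 vF => -[].
Qed.

Lemma chains_sub D E q c : D \subset E -> c \in chains k D q -> c \in chains k E q.
Proof. by move=> /subsetP DE /chainsP cD; apply/chainsP=> F /cD[/DE ? ?]. Qed.

(** Reduced homology is meant: [q = 0] covers the empty face, so the void complex is acyclic and the
    complex with only the empty face is not. *)
Definition acyclic D := forall q c, c \in chains k D q -> bd k T c = 0 ->
  exists2 g, g \in chains k D q.+1 & bd k T g = c.

Lemma cone_acyclic v D : (forall F, F \in D -> v |: F \in D) -> acyclic D.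
Proof.
move=> vD q c cD c0; exists (cone v c); last by rewrite bd_cone c0 raddf0 subr0.
by apply: cone_chains cD => F /vD.
Qed.

(** Gluing the star of [v] onto the acyclic complex [K]. If [d] is the part of [c] avoiding [v],
    then [d + g] is a cycle on [K]; for a filling [h] of it, [h - cone v g] has boundary [c]. *)
Lemma link_fill v D K q c g :
    (forall F, (F \in K) = (F \in D) && (v \notin F)) ->
    (forall F, F \in D -> F :\ v \in D) -> acyclic K ->
    c \in chains k D q -> bd k T c = 0 ->
    (forall F, g F != 0 -> [/\ v \notin F, v |: F \in D & #|F| = q]) ->
    link v c = bd k T g ->
  exists2 h, h \in chains k D q.+1 & bd k T h = c.
Proof.
move=> DK Dv aK cD c0 gL lg; have [d vd cE] := link_decomp v c.
have bdd : bd k T d = - link v c.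
  have := c0; rewrite {1}cE linearD /= bd_cone -[bd k T (link v c)]opprK -link_bd c0.
  by rewrite [link v 0]raddf0 oppr0 [cone v 0]raddf0 subr0 => /eqP;
    rewrite addr_eq0 => /eqP ->; rewrite opprK.
have gD : cone v g \in chains k D q.+1.
  apply/chainsP=> F; rewrite ffunE; case: ifPn => [vF|]; last by rewrite eqxx.
  rewrite mulf_eq0 negb_or => /andP[_ /gL[_ FD Fq]].
  by rewrite -{1}(setD1K vF) (cardsD1 v) vF Fq.
have [||h hK hE] := aK q (d + g).
- apply/chainsP=> F; rewrite ffunE => dg.
  have [gF|/gL[vF FD Fq]] := eqVneq (g F) 0; last first.
    by split=> //; rewrite DK vF andbT -[F](setU1K vF) Dv.
  rewrite gF addr0 in dg; have vF : v \notin F by apply: contraNN dg => /vd ->.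
  rewrite DK vF andbT; have /chainsP cD' := cD; apply: cD'; rewrite cE.
  by rewrite !ffunE (negPf vF) add0r.
- by rewrite linearD /= bdd lg addNr.
exists (h - cone v g).
  rewrite memvB //; apply: chains_sub hK.
  by apply/subsetP => F; rewrite DK => /andP[].
by rewrite linearB /= bd_cone hE -lg opprB addrA [d + g + _]addrAC addrK addrC -cE.
Qed.

End Cones.

(** * Order complexes of subsets of a poset *)

Section OrderComplexes.

Variables (k : fieldType) (disp : Order.disp_t) (P : finBPOrderType disp).
Local Open Scope order_scope.
Implicit Types (V F : {set P}) (a v w x : P).

Definition OC V : {set {set P}} :=
  [set F : {set P} | (F \subset V) && [forall x in F, forall y in F, x >=< y]].

Lemma OCP V F :
  reflect ({subset F <= V} /\ {in F &, forall x y, x >=< y}) (F \in OC V).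
Proof.
rewrite inE; apply: (iffP andP) => [[/subsetP FV /forall_inP cF]|[FV cF]]; split=> //.
- by move=> x y /cF /forall_inP; apply.
- exact/subsetP.
- by apply/forall_inP => x xF; apply/forall_inP => y; apply: cF.
Qed.

Lemma OC_sub V V' : V \subset V' -> OC V \subset OC V'.
Proof.
move=> /subsetP VV'; apply/subsetP => F /OCP[FV cF]; apply/OCP.
by split=> // x /FV/VV'.
Qed.

Lemma OC_facet V F F' : F' \subset F -> F \in OC V -> F' \in OC V.
Proof.
move=> /subsetP FF' /OCP[FV cF]; apply/OCP; split=> [x /FF'/FV //|].
exact: sub_in2 cF.
Qed.

Lemma OC_setU1 V F w :
    w \in V -> F \in OC V -> {in F, forall u, u >=< w} -> w |: F \in OC V.
Proof.
move=> wV /OCP[FV cF] Fw; apply/OCP; split=> [x /setU1P[->//|/FV //]|x y].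
case/setU1P=> [->|xF] /setU1P[->|yF]; first exact: comparablexx.
- by rewrite comparable_sym Fw.
- exact: Fw.
- exact: cF.
Qed.

Lemma OC_setD1 V v F : (F \in OC (V :\ v)) = (F \in OC V) && (v \notin F).
Proof. by rewrite !inE subsetD1 -!andbA; congr (_ && _); rewrite andbC. Qed.

Lemma OC_avoids V v q (c : {ffun {set P} -> k^o}) :
  c \in chains k (OC V) q -> v \notin V -> avoids v c.
Proof.
move=> /chainsP cV vV F vF; apply/eqP/negPn/negP => /cV[/OCP[FV _] _].
by rewrite FV in vV.
Qed.

Lemma OC_cone_acyclic V w : w \in V -> {in V, forall u, u >=< w} -> acyclic k (OC V).
Proof.
move=> wV Vw; apply: (@cone_acyclic _ _ w) => F FV; apply: OC_setU1 => // u.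
by case/OCP: FV => FV _ /FV/Vw.
Qed.

(** The link of [v] is a cone with apex [w], so the cycle [link v c] is filled by coning it from
    [w], and [link_fill] applies. *)
Lemma OC_setU1_acyclic V v w : v \notin V -> acyclic k (OC V) -> w \in V ->
    w >=< v -> {in V, forall u, u >=< v -> u >=< w} ->
  acyclic k (OC (v |: V)).
Proof.
move=> vV aV wV wv Vw q c cD c0.
have E F : (F \in OC V) = (F \in OC (v |: V)) && (v \notin F).
  by rewrite -OC_setD1 setU1K.
apply: (link_fill (g := cone w (link v c)) E _ aV cD c0).
- by move=> F; apply/OC_facet/subD1set.
- move=> F; rewrite !ffunE; case: ifPn => [wF|]; last by rewrite eqxx.
  case: ifPn => [|vFw]; first by rewrite mulr0 eqxx.
  rewrite !mulf_eq0 !negb_or => /and3P[_ _]; move/chainsP: cD => cD /cD[FD Fq].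
  have vw : v != w by apply: contraNneq vV => ->.
  have vF : v \notin F by move: vFw; rewrite !inE vw.
  split=> //; last by rewrite (cardsD1 w) wF -Fq cardsU1 vFw.
  rewrite -(setD1K wF) setUCA; apply: OC_setU1 => //; first by rewrite !inE wV orbT.
  case/OCP: FD => FD cF u uF; have /setU1P[->|uV] := FD u uF.
    by rewrite comparable_sym.
  by apply: Vw => //; apply: cF => //; apply: setU11.
- by rewrite bd_cone -[bd k P _]opprK -link_bd c0 [link v 0]raddf0 oppr0 [cone w 0]raddf0 subr0.
Qed.

Lemma covers_lt l a : covers l a -> l < a.
Proof. by case/andP. Qed.

(** Makes the size of the down-set a rank, by which maximal elements are selected. *)
Lemma lt_card_le x y : x < y -> (#|[set z : P | (z <= x)%O]| < #|[set z : P | (z <= y)%O]|)%N.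
Proof.
move=> xy; apply/proper_card/properP; split.
  by apply/subsetP => z; rewrite !inE => /le_trans -> //; apply: ltW.
by exists y; rewrite !inE // lt_geF.
Qed.

Lemma exists_cover x a : x < a -> exists2 l, covers l a & x <= l.
Proof.
move=> xa; pose p := [pred l | (x <= l) && (l < a)].
have px : p x by rewrite /= lexx.
case: (@arg_maxnP _ x p (fun l => #|[set z : P | (z <= l)%O]|) px) => l /andP[xl la] lmax.
exists l => //; rewrite /covers la; apply/forallP => b; apply/negP => /andP[lb ba].
have := lmax b; rewrite /= (le_trans xl (ltW lb)) ba => /(_ isT).
by rewrite leqNgt lt_card_le.
Qed.

Definition halfopen a : {set P} := [set x : P | \bot < x <= a].
Definition openI a : {set P} := [set x : P | \bot < x < a].

Lemma DcxE a : Dcx a = OC (halfopen a).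
Proof.
apply/setP => F; rewrite !inE; congr (_ && _).
by apply/forall_inP/subsetP => h x /h; rewrite inE.
Qed.

(** A nonempty chain lies below any coatom above its greatest element; the empty chain needs some
    coatom to exist, whence [a != \bot]. *)
Lemma DeltaE a : a != \bot -> Delta a = OC (openI a).
Proof.
move=> a0; apply/setP => F; apply/bigcupP/idP => [[l la]|].
  rewrite DcxE; apply/subsetP/OC_sub/subsetP => x; rewrite !inE => /andP[->].
  by move/le_lt_trans; apply; apply: covers_lt.
case/OCP=> FV cF; have [F0|[x0 x0F]] := set_0Vmem F.
  have [|l la _] := @exists_cover \bot a; first by rewrite lt0x.
  by exists l => //; rewrite DcxE F0; apply/OCP; split=> x; rewrite inE.
(* In a chain, the member with the largest down-set is the greatest one. *)
case: (@arg_maxnP _ x0 (mem F) (fun l => #|[set z : P | (z <= l)%O]|) x0F) => x xF xmax.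
have := FV x xF; rewrite inE => /andP[_ /exists_cover[l la xl]].
exists l => //; rewrite DcxE; apply/OCP; split=> // y yF.
have := FV y yF; rewrite !inE => /andP[-> _] /=; apply: le_trans xl.
have := cF y x yF xF; rewrite comparable_sym => /orP[|//].
rewrite le_eqVlt => /orP[/eqP->//|/lt_card_le].
by move/(leq_ltn_trans (xmax y yF)); rewrite ltnn.
Qed.

End OrderComplexes.

(** * Barycentric subdivision of simplices and their boundaries *)

Section Subdivision.

Variables (k : fieldType) (T P : finType) (apex : {set T} -> P).
Local Notation chain := {ffun {set P} -> k^o}.
Implicit Types (J : {set T}) (x : T).

(* [sd_simplex #|J| J] is the barycentric subdivision of the simplex [J], with
   barycenters given by [apex], and [sd_sphere J] that of its boundary. *)
Fixpoint sd_simplex s J : chain :=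
  if s is s'.+1 then
    cone (apex J) (\sum_(x in J) psign k x J *: sd_simplex s' (J :\ x))
  else simplex k set0.

Definition sd_sphere J : chain :=
  \sum_(x in J) psign k x J *: sd_simplex #|J|.-1 (J :\ x).

Definition sd (c : {ffun {set T} -> k^o}) : chain := \sum_J c J *: sd_simplex #|J| J.

Lemma sd_is_linear : linear sd.
Proof.
move=> a c c'; rewrite /sd scaler_sumr -big_split /=.
by apply: eq_bigr => F _; rewrite !ffunE scalerDl scalerA.
Qed.
HB.instance Definition _ := GRing.isLinear.Build k _ _ _ sd sd_is_linear.

Lemma sd_simplexE J : sd (simplex k J) = sd_simplex #|J| J.
Proof.
rewrite /sd (bigD1 J) //= big1 ?addr0 => [|F /negPf FJ].
  by rewrite ffunE eqxx scale1r.
by rewrite ffunE FJ scale0r.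
Qed.

Lemma sd_sphereE J : sd_sphere J = sd (bd k T (simplex k J)).
Proof.
rewrite bd_simplexE linear_sum; apply: eq_bigr => x xJ.
by rewrite linearZ /= sd_simplexE (cardsD1 x J) xJ.
Qed.

Lemma sd_simplexS J : J != set0 -> sd_simplex #|J| J = cone (apex J) (sd_sphere J).
Proof.
move=> /set0Pn[x xJ]; rewrite /sd_sphere.
by have -> : #|J| = #|J :\ x|.+1 by rewrite (cardsD1 x) xJ.
Qed.

(** By induction on size, the boundary of [sd_sphere J] is the subdivision of the double boundary of
    [J], hence 0; and the cone over a cycle has that cycle as its boundary. *)
Lemma bd_sd_simplex J : bd k P (sd_simplex #|J| J) = sd_sphere J.
Proof.
have [s] := ubnP #|J|; elim: s J => // s IH J; rewrite ltnS => Js.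
have [->|J0] := eqVneq J set0.
  by rewrite cards0 /= bd_simplexE /bd_simplex /sd_sphere !big_set0.
rewrite (sd_simplexS J0) bd_cone; suff -> : bd k P (sd_sphere J) = 0.
  by rewrite raddf0 subr0.
transitivity (sd (bd k T (bd k T (simplex k J)))); last by rewrite bd_bd linear0.
rewrite bd_simplexE /sd_sphere !linear_sum; apply: eq_bigr => x xJ.
rewrite !linearZ /= -sd_sphereE -IH ?(cardsD1 x J) ?xJ //.
by apply: leq_trans Js; rewrite [leqRHS](cardsD1 x J) xJ.
Qed.

Lemma bd_sd_sphere J : bd k P (sd_sphere J) = 0.
Proof. by rewrite -bd_sd_simplex bd_bd. Qed.

End Subdivision.

(** * Homology of open intervals in the Scarf face poset *)

Section FacePosetHomology.

Variables (k : fieldType) (n r : nat) (m : 'I_r -> 'X_{1..n}).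
Variable h0 : set0 \in scarf m.
Local Notation P := (scarf_poset h0).
Local Notation chain := {ffun {set P} -> k^o}.
Implicit Types (a b l u v : P) (J : {set 'I_r}).
Local Open Scope order_scope.

Definition face_of J : P := insubd (\bot : P) J.

Lemma val_face_of J : J \in scarf m -> val (face_of J) = J.
Proof. by move=> JS; rewrite val_insubd JS. Qed.

Lemma face_lt a b : (a < b) = (val a \proper val b).
Proof. by rewrite lt_neqAle scarf_poset_le properEneq -(inj_eq val_inj). Qed.

Lemma face_neq0 a : (a != \bot) = (val a != set0).
Proof. by rewrite -(inj_eq val_inj). Qed.

Lemma face_mem_sub a J : J \subset val a -> J \in scarf m.
Proof. exact: scarf_subset (valP a). Qed.

Definition facet a (x : 'I_r) : P := face_of (val a :\ x).

Lemma val_facet a x : val (facet a x) = val a :\ x.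
Proof. by apply/val_face_of/face_mem_sub/subD1set. Qed.

(** Subsets of a face are faces, so deleting from [a] one vertex missing in [l] gives an element
    between [l] and [a]. *)
Lemma coversP l a :
  reflect (exists2 x, x \in val a & val l = val a :\ x) (covers l a).
Proof.
apply: (iffP andP) => [[la /forallP noB]|[x xa lE]].
  have /properP[lsa [x xa xl]] : val l \proper val a by rewrite -face_lt.
  exists x => //; apply/eqP; rewrite eqEsubset subsetD1 lsa xl /=.
  have := noB (facet a x); apply: contraNT => nle.
  rewrite !face_lt val_facet properD1 // andbT properE nle andbT.
  by rewrite subsetD1 lsa.
rewrite face_lt lE properD1 //; split=> //; apply/forallP => b; apply/negP.
rewrite !face_lt lE => /andP[/properP[sb [y yb ya]] ba].
have /properP[bsa [z za zb]] := ba.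
have yx : y = x.
  by move: ya; rewrite !inE (subsetP bsa y yb) andbT negbK => /eqP.
have [zx|zx] := eqVneq z x; first by rewrite zx -yx yb in zb.
by case/negP: zb; apply: (subsetP sb); rewrite !inE zx.
Qed.

(* The faces containing [x] form a cone with apex [set x]; the others are added
   back by increasing size, and the link of such a face [v] at that stage is a
   cone with apex [x |: v]. *)
Lemma punctured_acyclic a x :
  x \in val a -> facet a x != \bot -> acyclic k (OC (openI a :\ facet a x)).
Proof.
move=> xa fx0.
pose Q1 : {set P} := [set y in openI a :\ facet a x | x \in val y].
have add_x u : u \in openI a :\ facet a x -> face_of (x |: val u) \in Q1 /\
    val (face_of (x |: val u)) = x |: val u.
  rewrite !inE => /and3P[ufx _ ua].
  have ua' : x |: val u \proper val a.
    move: ua; rewrite face_lt !properEneq subUset sub1set xa => /andP[una usa].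
    rewrite usa !andbT; apply/eqP => xua; case/negP: una.
    have [xu|xu] := boolP (x \in val u); first by rewrite -xua (setUidPr _) ?sub1set.
    by case/eqP: ufx; apply: val_inj; rewrite val_facet -xua setU1K.
  have E : val (face_of (x |: val u)) = x |: val u.
    by apply/val_face_of/(face_mem_sub (proper_sub ua')).
  rewrite E setU11 andbT lt0x face_neq0 E face_lt E ua' andbT; split=> //.
  apply/andP; split; last by apply/set0Pn; exists x; rewrite setU11.
  apply/eqP => /(congr1 val); rewrite E val_facet => /setP/(_ x).
  by rewrite !inE !eqxx.
(* A second vertex of [a] makes [[set x]] a proper face, so that the apex lies in the open
   interval. *)
have {}fx0 : exists2 y, y \in val a & y != x.
  by move: fx0; rewrite face_neq0 val_facet => /set0Pn[y]; rewrite !inE => /andP[]; exists y.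
have xQ1 : face_of [set x] \in Q1 /\ val (face_of [set x]) = [set x].
  have E : val (face_of [set x]) = [set x].
    by apply/val_face_of/(@face_mem_sub a); rewrite sub1set.
  split=> //; rewrite !inE E set11 andbT lt0x face_neq0 E face_lt E.
  apply/and3P; split.
  - by apply/eqP => /(congr1 val); rewrite E val_facet => /setP/(_ x); rewrite !inE eqxx.
  - by apply/set0Pn; exists x; rewrite set11.
  - have [y ya yx] := fx0; apply/properP; rewrite sub1set xa; split=> //.
    by exists y; rewrite ?inE.
suff H s (V : {set P}) : (#|V :\: Q1| < s)%N -> Q1 \subset V ->
    V \subset openI a :\ facet a x -> acyclic k (OC V).
  by apply: (H _.+1) => //; apply/subsetP => y; rewrite inE => /andP[].
elim: s V => // s IH V; rewrite ltnS => Vs Q1V VQ.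
have [VQ1|[v0 v0V]] := set_0Vmem (V :\: Q1).
  have {}VQ1 : V = Q1 by apply/eqP; rewrite eqEsubset Q1V andbT -setD_eq0 VQ1.
  have [xQ xE] := xQ1; rewrite VQ1; apply: (OC_cone_acyclic xQ) => u.
  by rewrite inE /Order.comparable !scarf_poset_le xE !sub1set => /andP[_ ->]; rewrite orbT.
(* Since [v] has maximal size, every element of [V] strictly above [v] contains [x] and hence lies
   above [x |: v]; elements below [v] lie below [x |: v] anyway. *)
case: (@arg_maxnP _ v0 (mem (V :\: Q1)) (fun u => #|val u|) v0V) => v /= vV vmax.
have := vV; rewrite inE => /andP[vQ1 vV'].
have vQ := subsetP VQ v vV'; have [wQ1 wE] := add_x v vQ.
have xv : x \notin val v by apply: contraNN vQ1 => xv; rewrite inE vQ.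
have wv : face_of (x |: val v) != v.
  by apply: contraNneq xv => <-; rewrite wE setU11.
rewrite -(setD1K vV'); apply: (@OC_setU1_acyclic _ _ _ _ _ (face_of (x |: val v))).
- by rewrite setD11.
- apply: IH; first 2 last.
  + by apply: subset_trans VQ; apply: subD1set.
  + apply: leq_trans Vs; rewrite [leqRHS](cardsD1 v) vV ltnS.
    by apply/subset_leq_card/subsetP => u; rewrite !inE => /and3P[-> -> ->].
  + by rewrite subsetD1 Q1V.
- by rewrite !inE wv (subsetP Q1V).
- by rewrite /Order.comparable !scarf_poset_le wE subsetUr orbT.
move=> u; rewrite !inE => /andP[uv uV] /orP[uv'|vu].
  rewrite /Order.comparable !scarf_poset_le wE.
  by rewrite (subset_trans uv') ?subsetUr.
rewrite /Order.comparable !scarf_poset_le wE; apply/orP; right.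
have vu' := vu; rewrite scarf_poset_le in vu'.
rewrite subUset sub1set vu' andbT; apply/negPn/negP => xu.
have uQ1 : u \in V :\: Q1 by rewrite !inE uV (negPf xu) andbF.
have := vmax u uQ1; rewrite /= leqNgt proper_card // -face_lt lt_neqAle vu.
by rewrite eq_sym uv.
Qed.

(** The facet is a coatom, so anything in the interval comparable with it and distinct from it lies
    below it. Together with [facet_openI] this identifies the link of the facet. *)
Lemma openI_facet a x (F : {set P}) : x \in val a -> facet a x \notin F ->
  facet a x |: F \in OC (openI a) -> F \in OC (openI (facet a x)).
Proof.
move=> xa xF /OCP[Fa cF]; apply/OCP; split; last first.
  by move=> y z yF zF; apply: cF; rewrite inE ?yF ?zF orbT.
move=> y yF; have yF' : y \in facet a x |: F by rewrite inE yF orbT.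
have := Fa y yF'; rewrite !inE => /andP[-> ya] /=.
have ne : y != facet a x by apply: contraNneq xF => <-.
rewrite lt_neqAle ne /=; have := cF y (facet a x) yF' (setU11 _ _).
rewrite /Order.comparable => /orP[//|xy]; exfalso.
have /andP[_ /forallP/(_ y)] : covers (facet a x) a.
  by apply/coversP; exists x; rewrite ?val_facet.
by rewrite ya lt_neqAle eq_sym ne xy.
Qed.

Lemma facet_lt a x : x \in val a -> facet a x < a.
Proof. by move=> xa; rewrite face_lt val_facet properD1. Qed.

Lemma facet_openI a x (F : {set P}) : x \in val a -> facet a x != \bot ->
  F \in OC (openI (facet a x)) -> facet a x |: F \in OC (openI a).
Proof.
move=> xa fx0 Fx; have lt := facet_lt xa; apply: OC_setU1.
- by rewrite inE lt0x fx0.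
- apply: (subsetP (OC_sub _)) Fx; apply/subsetP => y; rewrite !inE => /andP[-> /=].
  by move/lt_trans; apply.
- by move=> u uF; have /OCP[/(_ u uF)] := Fx; rewrite inE => /andP[_ /lt_comparable].
Qed.

Lemma card_facet a x : x \in val a -> #|val (facet a x)| = #|val a|.-1.
Proof. by move=> xa; rewrite val_facet (cardsD1 x (val a)) xa. Qed.

Lemma face_of_val a : face_of (val a) = a.
Proof. exact: valKd. Qed.

Local Notation simp a := (sd_simplex k face_of #|val a| (val a)).
Local Notation sphere a := (sd_sphere k face_of (val a)).

Lemma sd_sphere_facets a :
  sphere a = \sum_(x in val a) psign k x (val a) *: simp (facet a x).
Proof. by apply: eq_bigr => x xa; rewrite card_facet // val_facet. Qed.

Lemma sd_chains a : simp a \in chains k (OC (halfopen a)) #|val a| /\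
  sphere a \in chains k (OC (openI a)) #|val a|.-1.
Proof.
have [s] := ubnP #|val a|; elim: s a => // s IH a; rewrite ltnS => ls.
have sph : sphere a \in chains k (OC (openI a)) #|val a|.-1.
  rewrite sd_sphere_facets; apply: memv_suml => x xa; apply: memvZ.
  have [|+ _] := IH (facet a x).
    by apply: leq_trans ls; rewrite card_facet // prednK // (cardsD1 x) xa.
  rewrite card_facet //; apply: chains_sub.
  apply/OC_sub/subsetP => y; rewrite !inE => /andP[-> /le_lt_trans]; apply.
  exact: facet_lt.
split=> //; have [a0|a0] := eqVneq (val a) set0.
  rewrite a0 cards0 /=; apply/chainsP => F; rewrite ffunE.
  case: (F =P set0) => [-> _|]; last by rewrite eqxx.
  by rewrite cards0; split=> //; apply/OCP; split=> y; rewrite inE.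
rewrite sd_simplexS // -[X in chains _ _ X](@prednK #|val a|) ?card_gt0 //.
apply: cone_chains sph => F Fa _; rewrite face_of_val.
have a0' : a != \bot by rewrite face_neq0.
apply: OC_setU1; first by rewrite inE lexx lt0x a0'.
  apply: (subsetP (OC_sub _)) Fa; apply/subsetP => y; rewrite !inE => /andP[-> /=].
  exact: ltW.
by move=> u uF; have /OCP[/(_ u uF)] := Fa; rewrite inE => /andP[_ /lt_comparable].
Qed.

(** Only the summand of [facet a x] involves that vertex, and this summand is the cone from it over
    its own sphere. *)
Lemma link_sphere a x : x \in val a -> facet a x != \bot ->
  link (facet a x) (sphere a) = psign k x (val a) *: sphere (facet a x).
Proof.
move=> xa fx0; rewrite sd_sphere_facets linear_sum (bigD1 x) //= big1 ?addr0.
  rewrite linearZ /= sd_simplexS -?face_neq0 // face_of_val link_cone //.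
  by apply: OC_avoids (sd_chains _).2 _; rewrite inE ltxx andbF.
move=> y /andP[ya yx]; rewrite linearZ /= link_eq0 ?scaler0 //.
apply: OC_avoids (sd_chains _).1 _; rewrite inE negb_and scarf_poset_le !val_facet.
apply/orP; right; apply/negP => /subsetP/(_ y); rewrite !inE eqxx yx ya.
by move=> /(_ isT).
Qed.

Lemma OC0P (F : {set P}) a x : val a = [set x] -> F \in OC (openI a) -> F = set0.
Proof.
move=> ax /OCP[Fa _]; apply/setP => y; rewrite inE; apply/negP => /Fa.
rewrite inE lt0x face_neq0 face_lt ax => /andP[y0]; rewrite properE subset1 (negPf y0) orbF.
by case/andP => /eqP ->; rewrite subxx.
Qed.

(** Induction on dimension: the link of [c] at a facet is, up to a boundary, a multiple of the
    smaller sphere. Subtracting the matching multiple of [sphere a] makes the link a boundary, and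
    the complement of the facet is acyclic. The clause on [t] also records vanishing in all other
    degrees. *)
Lemma sphere_homology s a j (c : chain) : #|val a| = s.+1 ->
    c \in chains k (OC (openI a)) j -> bd k P c = 0 ->
  exists2 t : k, t != 0 -> j = s &
    exists2 h, h \in chains k (OC (openI a)) j.+1 & bd k P h = c - t *: sphere a.
Proof.
elim: s a j c => [|s IH] a j c as_ cj c0.
  (* For a vertex the open interval is empty: only the empty chain remains, and [sphere a] is a
     signed copy of it. *)
  have /cards1P[x ax] : #|val a| == 1%N by rewrite as_.
  have cE : c = c set0 *: simplex k set0.
    apply/ffunP=> F; rewrite !ffunE; case: eqP => [->|F0].
      by rewrite /GRing.scale /= mulr1.
    rewrite scaler0; apply/eqP/negPn/negP; move/chainsP: cj => /[apply] -[].
    by move=> /(OC0P ax).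
  have sE : sphere a = psign k x (val a) *: simplex k set0.
    by rewrite /sd_sphere as_ /= {1}ax big_set1.
  exists (c set0 * psign k x (val a)).
    rewrite mulf_eq0 negb_or => /andP[cn0 _]; move/chainsP: cj => /(_ _ cn0)[_].
    by rewrite cards0.
  exists 0; first exact: mem0v.
  by rewrite linear0 sE scalerA -mulrA psign2 mulr1 -cE subrr.
have [x xa] : exists x, x \in val a by apply/set0Pn; rewrite -card_gt0 as_.
have vs : #|val (facet a x)| = s.+1 by rewrite card_facet // as_.
have fx0 : facet a x != \bot by rewrite face_neq0 -card_gt0 vs.
have DK F : (F \in OC (openI a :\ facet a x)) = (F \in OC (openI a)) && (facet a x \notin F).
  exact: OC_setD1.
have Dv F : F \in OC (openI a) -> F :\ facet a x \in OC (openI a).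
  by apply/OC_facet/subD1set.
have aK := punctured_acyclic xa fx0.
(* A chain of degree 0 is supported on the empty face and has zero link, so it is filled without
   subtracting a sphere. *)
case: j cj => [|j] cj.
  exists 0; first by rewrite eqxx.
  apply: (link_fill (g := 0) DK Dv aK).
  - by rewrite scale0r subr0.
  - by rewrite scale0r subr0.
  - by move=> F; rewrite ffunE eqxx.
  - rewrite scale0r subr0 linear0; apply/ffunP => F; rewrite !ffunE.
    case: ifPn => // xF; have [->|] := eqVneq (c (facet a x |: F)) 0; first by rewrite mulr0.
    by move/chainsP: cj => /[apply] -[_]; rewrite cardsU1 xF.
have lc : link (facet a x) c \in chains k (OC (openI (facet a x))) j.
  by apply: link_chains cj => F FD xF; apply: openI_facet FD.
have [|t tj [g gD gE]] := IH _ _ _ vs lc; first by rewrite -[LHS]opprK -link_bd c0 raddf0 oppr0.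
(* [link_sphere] contributes a second factor [psign], which cancels this one. *)
exists (t * psign k x (val a)).
  by rewrite mulf_eq0 negb_or => /andP[/tj -> _].
apply: (link_fill (g := g) DK Dv aK).
- rewrite memvB //; have [->|/tj js] := eqVneq t 0; first by rewrite mul0r scale0r mem0v.
  by apply: memvZ; rewrite js; have := (sd_chains a).2; rewrite as_.
- by rewrite linearB linearZ /= c0 bd_sd_sphere scaler0 subrr.
- move=> F; move/chainsP: gD => /[apply] -[FD Fj]; split=> //; last exact: facet_openI.
  by apply/negP => /(OCP _ _ FD).1; rewrite inE ltxx andbF.
by rewrite linearB linearZ /= link_sphere // scalerA -mulrA psign2 mulr1 gE.
Qed.

(** Up to sign, the link of a filling fills the sphere of a facet; the descent ends at a vertex,
    where there are no chains of degree 1 and the sphere is nonzero. *)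
Lemma sphere_not_boundary s a (h : chain) : #|val a| = s.+1 ->
  h \in chains k (OC (openI a)) s.+1 -> bd k P h <> sphere a.
Proof.
elim: s a h => [|s IH] a h as_ hD hE.
  have /cards1P[x ax] : #|val a| == 1%N by rewrite as_.
  have h0' : h = 0.
    apply/ffunP=> F; rewrite [RHS]ffunE; apply/eqP/negPn/negP.
    by move/chainsP: hD => /[apply] -[/(OC0P ax) ->]; rewrite cards0.
  have : sphere a = psign k x (val a) *: simplex k set0.
    by rewrite /sd_sphere as_ /= {1}ax big_set1.
  rewrite -hE h0' linear0 => /ffunP/(_ set0); rewrite !ffunE eqxx.
  rewrite /GRing.scale /= mulr1 => /esym/eqP.
  by apply/negP; rewrite /psign signr_eq0.
have [x xa] : exists x, x \in val a by apply/set0Pn; rewrite -card_gt0 as_.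
have vs : #|val (facet a x)| = s.+1 by rewrite card_facet // as_.
have fx0 : facet a x != \bot by rewrite face_neq0 -card_gt0 vs.
apply: (IH _ (- psign k x (val a) *: link (facet a x) h) vs).
  by apply: memvZ; apply: link_chains hD => F FD xF; apply: openI_facet FD.
by rewrite linearZ /= scaleNr -scalerN -link_bd hE link_sphere // scalerA psign2 scale1r.
Qed.

End FacePosetHomology.

(** * Resolutions isomorphic by a rescaled bijection of the generators *)

Section Transport.

Variables (k : fieldType) (n : nat) (F G : mgseq k n).
Local Notation R := {mpoly k[n]}.

Variables (h : forall i, gen F i -> gen G i) (u : forall i, gen F i -> k).
Arguments u {i}.
Arguments h {i}.
Hypothesis bij_h : forall i, bijective (@h i).
Hypothesis u0 : forall i (e : gen F i), u e != 0.
Hypothesis h_deg : forall i (e : gen F i), gdeg e = gdeg (h e).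
Hypothesis h_entry : forall i (e : gen F i.+1) (e' : gen F i),
  u e' *: entry e e' = u e *: entry (h e) (h e').

(** Sends the generator [e] to [u e] times [h e]; the fibre of [h] has one element, and summing over
    it avoids naming an inverse. By [h_entry] this is a map of complexes. *)
Let T i (f : mgmod F i) : mgmod G i := [ffun x => \sum_(e | h e == x) u e *: f e].

Let TE i (f : mgmod F i) e : T f (h e) = u e *: f e.
Proof.
rewrite ffunE (bigD1 e) //= big1 ?addr0 // => e' /andP[/eqP he /negP []].
by apply/eqP/(bij_inj (bij_h i)).
Qed.

Let T_ext i (f g : mgmod G i) : (forall e, f (h e) = g (h e)) -> f = g.
Proof. by move=> fg; apply/ffunP=> x; have [h' _ h'K] := bij_h i; rewrite -(h'K x). Qed.

Let T_inj i (f g : mgmod F i) : T f = T g -> f = g.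
Proof.
move=> /ffunP Tfg; apply/ffunP=> e; have := Tfg (h e); rewrite !TE.
by move/(congr1 (fun p : R => (u e)^-1 *: p)); rewrite !scalerA mulVf ?scale1r.
Qed.

Let T_surj i (g : mgmod G i) : exists f, T f = g.
Proof.
exists [ffun e => (u e)^-1 *: g (h e)]; apply: T_ext => e.
by rewrite TE ffunE scalerA mulfV ?scale1r.
Qed.

Let T_mgdiff i (f : mgmod F i.+1) : mgdiff (T f) = T (mgdiff f).
Proof.
apply: T_ext => e'; rewrite TE !ffunE scaler_sumr (reindex _ (onW_bij _ (bij_h _))).
apply: eq_bigr => e _; rewrite TE -scalerAl scalerAr -h_entry.
by rewrite -scalerAr.
Qed.

Let T0 i : T (0 : mgmod F i) = 0.
Proof. by apply: T_ext => e; rewrite TE !ffunE scaler0. Qed.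

Lemma minimal_free_resolution_iso (N : R -> Prop) :
  minimal_free_resolution N G -> minimal_free_resolution N F.
Proof.
move=> [homG exG [aug [aug_deg aug_surj aug_ker]] minG].
have entryE i (e : gen F i.+1) e' :
    entry e e' = ((u e')^-1 * u e) *: entry (h e) (h e').
  by rewrite -scalerA -h_entry scalerA mulVf // scale1r.
split.
- by move=> i e e' v; rewrite entryE => /msuppZ_le /homG; rewrite !h_deg.
- move=> i f; split=> [f0|[g ->]].
    have /exG[g'] : mgdiff (T f) = [ffun=> 0] by rewrite T_mgdiff f0 T0.
    have [g <-] := T_surj g'; rewrite T_mgdiff => /T_inj fg.
    by exists g.
  by apply: T_inj; rewrite -!T_mgdiff T0; apply/exG; exists (T g).
- have augE (f : mgmod F 0) :
      \sum_e f e * (u e *: aug (h e)) = \sum_x T f x * aug x.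
    rewrite (reindex _ (onW_bij _ (bij_h _))); apply: eq_bigr => e _.
    by rewrite TE -scalerAr scalerAl.
  exists (fun e => u e *: aug (h e)); split.
  + by move=> e v /msuppZ_le /aug_deg; rewrite h_deg.
  + move=> p; have [g] := aug_surj p; have [f <-] := T_surj g.
    by rewrite -augE => Nf; exists f.
  move=> f; rewrite augE; split=> [/aug_ker[g']|[g ->]].
    by have [g <-] := T_surj g'; rewrite T_mgdiff => /T_inj; exists g.
  by apply/aug_ker; exists (T g); rewrite T_mgdiff.
- by move=> i e e'; rewrite entryE mcoeffZ minG mulr0.
Qed.

End Transport.

(** * Calculus of homology classes and of the connecting map *)

Section HomologyClasses.

Variables (k : fieldType) (T : finType).
Local Notation chain := {ffun {set T} -> k^o}.
Implicit Types (D E : {set {set T}}) (c b : chain).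

(** The second projection fixes boundaries and the two projections add up to the identity, so the
    first kills boundaries. *)
Lemma hclass_boundary D q b : b \in boundaries k D q -> hclass k D q b = 0.
Proof.
move=> bB; have bZB : b \in (cycles k D q + boundaries k D q)%VS.
  by rewrite -[b]add0r memv_add ?mem0v.
have := addv_pi1_pi2 bZB; rewrite addv_pi2_id //.
by move=> /(congr1 (fun x => x - b)); rewrite addrK subrr.
Qed.

Lemma hclass_decomp D q c : c \in cycles k D q ->
  exists2 b, b \in boundaries k D q & hclass k D q c = c - b.
Proof.
move=> cZ; have cZB : c \in (cycles k D q + boundaries k D q)%VS.
  by rewrite -[c]addr0 memv_add ?mem0v.
exists (addv_pi2 (cycles k D q) (boundaries k D q) c); first exact: memv_pi2.
by apply/esym/eqP; rewrite subr_eq; apply/eqP/esym/(addv_pi1_pi2 cZB).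
Qed.

Lemma cyclesP D q c :
  reflect (c \in chains k D q /\ bd k T c = 0) (c \in cycles k D q).
Proof.
by rewrite memv_cap memv_ker; apply: (iffP andP) => -[cD /eqP c0].
Qed.

Lemma boundariesP D q c :
  reflect (exists2 g, g \in chains k D q.+1 & bd k T g = c) (c \in boundaries k D q).
Proof. by apply: (iffP memv_imgP) => -[g gD gE]; exists g. Qed.

Lemma bd_chains D q c : (forall F v, F \in D -> F :\ v \in D) ->
  c \in chains k D q.+1 -> bd k T c \in chains k D q.
Proof.
move=> Dv /chainsP cD; apply/chainsP=> F; rewrite bdE => nz.
have [v /andP[vF cF]] : exists v, (v \notin F) && (c (v |: F) != 0).
  apply/existsP; apply: contraNT nz => /existsPn nv.
  rewrite big1 // => v vF; have := nv v; rewrite vF negbK => /eqP ->.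
  by rewrite mulr0.
have [FD /eqP] := cD _ cF; rewrite cardsU1 vF => /eqP[Fq]; split=> //.
by rewrite -(setU1K vF) Dv.
Qed.

Lemma hclass_sub D E q c : D \subset E -> c \in cycles k D q ->
  hclass k E q (hclass k D q c) = hclass k E q c.
Proof.
move=> DE /hclass_decomp[b /boundariesP[g gD gE] ->].
rewrite linearB /= [X in _ - X]hclass_boundary ?subr0 //.
by apply/boundariesP; exists g => //; apply: chains_sub gD.
Qed.

Lemma restr_decomp D E q c : c \in chains k (D :|: E) q ->
  exists c' c'', [/\ c' \in chains k D q, c'' \in chains k E q & c = c' + c''].
Proof.
move=> /chainsP cDE; exists (restr k D c), (c - restr k D c).
have rE F : restr k D c F = if F \in D then c F else 0.
  by rewrite lfunE /= ffunE.
split; last by rewrite addrC subrK.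
  by apply/chainsP=> F; rewrite rE; case: ifP => FD; [case/cDE|rewrite eqxx].
apply/chainsP=> F; rewrite !ffunE rE; case: ifP => FD; first by rewrite subrr eqxx.
by rewrite subr0 => /cDE[]; rewrite inE FD.
Qed.

(** [hclass] may replace the cycle by another representative. The difference is the boundary of some
    [g' + g''] split along [D] and [E], and its connecting image is the class of the double boundary
    of [g'], which is 0. *)
Lemma mv_connect_hclass D E q c' c'' :
    (forall F v, F \in D -> F :\ v \in D) -> (forall F v, F \in E -> F :\ v \in E) ->
    c' \in chains k D q.+1 -> c'' \in chains k E q.+1 -> bd k T (c' + c'') = 0 ->
  mv_connect k D E q (hclass k (D :|: E) q.+1 (c' + c'')) = hclass k (D :&: E) q (bd k T c').
Proof.
move=> Dv Ev c'D c''E bd0.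
have cZ : c' + c'' \in cycles k (D :|: E) q.+1.
  apply/cyclesP; split=> //; apply: memvD.
    by apply: chains_sub c'D; apply: subsetUl.
  by apply: chains_sub c''E; apply: subsetUr.
have [b /boundariesP[g gDE gE] ->] := hclass_decomp cZ.
rewrite linearB /= mv_connectE // -[RHS]subr0; congr (_ - _).
have [g' [g'' [g'D g''E gg]]] := restr_decomp gDE.
rewrite -gE gg linearD /= mv_connectE.
- by rewrite bd_bd linear0.
- exact: bd_chains.
- exact: bd_chains.
apply/cyclesP; rewrite -linearD /= bd_bd; split=> //.
rewrite linearD; apply: memvD.
  by apply: (chains_sub (subsetUl _ _)); apply: bd_chains.
by apply: (chains_sub (subsetUr _ _)); apply: bd_chains.
Qed.

Lemma homology_line D q c : hclass k D q c != 0 ->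
    {in cycles k D q, forall c', exists t : k, c' - t *: c \in boundaries k D q} ->
  homology k D q = <[hclass k D q c]>%VS.
Proof.
move=> c0 span; apply/eqP; rewrite eqEsubv; apply/andP; split; last first.
  by rewrite -memvE hclass_mem.
apply/subvP=> c' c'H; have [|t bt] := span c'; first exact: subvP (diffvSl _ _) _ c'H.
have c'E : c' = t *: c + (c' - t *: c) by rewrite addrC subrK.
move: (c' - t *: c) bt c'E => b bB c'E.
rewrite -(hclass_id c'H) c'E linearD linearZ /= (hclass_boundary bB) addr0.
exact/memvZ/memv_line.
Qed.

End HomologyClasses.

(** * Identification of F(eta) with the Scarf resolution *)

Section EtaScarf.

Variables (k : fieldType) (n r : nat) (m : 'I_r -> 'X_{1..n}).
Variable h0 : set0 \in scarf m.
Local Notation P := (scarf_poset h0).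
Local Notation chain := {ffun {set P} -> k^o}.
Local Notation simp a := (sd_simplex k (@face_of _ _ _ h0) #|val a| (val a)).
Local Notation sphere a := (sd_sphere k (@face_of _ _ _ h0) (val a)).
Implicit Types (a l : P).
Local Open Scope order_scope.

Lemma sphere_cycle a j : a != \bot -> #|val a| = j.+1 ->
  sphere a \in cycles k (Delta a) j.
Proof.
move=> a0 aj; apply/cyclesP; rewrite bd_sd_sphere DeltaE //; split=> //.
by have := (sd_chains k a).2; rewrite aj.
Qed.

Definition sphere_class j a : chain := hclass k (Delta a) j (sphere a).

Lemma sphere_class_neq0 j a : a != \bot -> #|val a| = j.+1 -> sphere_class j a != 0.
Proof.
move=> a0 aj; rewrite hclass_eq0 ?sphere_cycle //.
apply/negP => /boundariesP[g]; rewrite DeltaE //.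
exact: sphere_not_boundary.
Qed.

Lemma CposE j a : a != \bot -> #|val a| = j.+1 -> Cpos k j a = <[sphere_class j a]>%VS.
Proof.
move=> a0 aj; apply: homology_line; first exact: sphere_class_neq0.
move=> c /cyclesP[cD c0]; rewrite DeltaE // in cD *.
have [t _ [g gD gE]] := sphere_homology aj cD c0.
by exists t; apply/boundariesP; exists g.
Qed.

Lemma Cpos_eq0 j a : a != \bot -> #|val a| != j.+1 -> Cpos k j a = 0%VS.
Proof.
move=> a0 aj; apply/eqP; rewrite -subv0; apply/subvP => c cC.
have /cyclesP[cD c0] := subvP (diffvSl _ _) _ cC.
have [s as_] : exists s, #|val a| = s.+1.
  by exists #|val a|.-1; rewrite prednK // card_gt0 -face_neq0.
have [t ts [g gD gE]] : exists2 t : k, t != 0 -> j = s &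
    exists2 h, h \in chains k (OC (openI a)) j.+1 & bd k P h = c - t *: sphere a.
  by apply: sphere_homology => //; rewrite -DeltaE.
have t0 : t = 0.
  by apply/eqP; apply: contraNT aj => /ts ->; rewrite as_.
rewrite -(hclass_id cC) hclass_boundary ?mem0v //; apply/boundariesP.
by exists g; rewrite ?DeltaE // gE t0 scale0r subr0.
Qed.

Definition point_class : chain := hclass k [set set0] 0 (simplex k set0).

Lemma chains_point q (c : chain) : c \in chains k [set set0] q ->
  c = c set0 *: simplex k set0 /\ (c != 0 -> q = 0%N).
Proof.
move=> /chainsP cD; have cE : c = c set0 *: simplex k set0.
  apply/ffunP=> F; rewrite !ffunE; case: (F =P set0) => [->|F0].
    by rewrite /GRing.scale /= mulr1.
  by rewrite scaler0; apply/eqP/negPn/negP => /cD[]; rewrite inE => /eqP.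
split=> // cn0; have c0 : c set0 != 0.
  by apply: contraNneq cn0 => c0; rewrite cE c0 scale0r.
by have [_ <-] := cD _ c0; rewrite cards0.
Qed.

Lemma simplex0_cycle : simplex k (set0 : {set P}) \in cycles k [set set0] 0.
Proof.
apply/cyclesP; split; last by rewrite bd_simplexE /bd_simplex big_set0.
apply/chainsP=> F; rewrite ffunE; case: (F =P set0) => [-> _|_]; last by rewrite eqxx.
by rewrite inE cards0.
Qed.

Lemma point_class_neq0 : point_class != 0.
Proof.
rewrite hclass_eq0 ?simplex0_cycle //; apply/negP => /boundariesP[g /chains_point[_ g0]].
have [->|/g0 //] := eqVneq g 0.
rewrite linear0 => /ffunP/(_ set0)/eqP; rewrite !ffunE eqxx.
by rewrite eq_sym oner_eq0.
Qed.

Lemma C0E : C0 k P = <[point_class]>%VS.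
Proof.
apply: homology_line; first exact: point_class_neq0.
move=> c /cyclesP[/chains_point[cE _] _]; exists (c set0).
by rewrite [X in X - _]cE subrr mem0v.
Qed.

(** Below an atom only the empty chain remains. The sign equals 1 and is written as [psign] to match
    [scarf_entryE]. *)
Lemma phi1_sphere a x : val a = [set x] ->
  phi1 k P (sphere_class 0 a) = psign k x (val a) *: point_class.
Proof.
move=> ax; have a0 : a != \bot.
  by rewrite face_neq0 ax; apply/set0Pn; exists x; rewrite set11.
have Da : Delta a = [set set0].
  apply/setP => F; rewrite DeltaE // in_set1; apply/idP/eqP => [/(OC0P ax) //|->].
  by apply/OCP; split=> y; rewrite inE.
rewrite /phi1 /sphere_class Da hclass_id ?hclass_mem //.
rewrite -linearZ; congr (hclass _ _ _ _).
by rewrite /sd_sphere ax cards1 big_set1.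
Qed.

Lemma Delta_other a l : covers l a -> Delta a = Dcx l :|: Dother a l.
Proof. by move=> la; rewrite /Delta (bigD1 l). Qed.

(** A chain through [l] that also lies below another coatom [b] would put [l] strictly between
    nothing but [b]: [l <= b < a] forces [b = l]. *)
Lemma Delta2_sub a l : covers l a -> l != \bot -> Delta2 a l \subset Delta l.
Proof.
move=> la l0; apply/subsetP => F; rewrite inE DeltaE // => /andP[].
rewrite DcxE => /OCP[Fl cF] /bigcupP[b /andP[ba bl]]; rewrite DcxE => /OCP[Fb _].
apply/OCP; split=> // y yF; have := Fl y yF; rewrite !inE => /andP[-> yl] /=.
rewrite lt_neqAle yl andbT; apply: contraNneq bl => yE.
have := Fb y yF; rewrite inE yE => /andP[_ lb].
have /andP[_ /forallP/(_ b)] := la.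
by rewrite (covers_lt ba) andbT lt_neqAle lb andbT negbK eq_sym.
Qed.

Lemma phi_sphere j a l x : covers l a -> l != \bot -> #|val a| = j.+2 ->
    x \in val a -> val l = val a :\ x ->
  phi k j a l (sphere_class j.+1 a) = psign k x (val a) *: sphere_class j l.
Proof.
move=> la l0 aj xa lx; have lE : l = facet a x by apply: val_inj; rewrite val_facet.
have lj : #|val l| = j.+1 by rewrite lE card_facet // aj.
pose c' := psign k x (val a) *: simp l.
pose c'' := \sum_(y in val a | y != x) psign k y (val a) *: simp (facet a y).
have sE : sphere a = c' + c'' by rewrite sd_sphere_facets (bigD1 x) //= -lE.
have c'D : c' \in chains k (Dcx l) j.+1.
  by apply: memvZ; rewrite DcxE -lj; apply: (sd_chains k l).1.
have c''D : c'' \in chains k (Dother a l) j.+1.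
  apply: memv_suml => y /andP[ya yx]; apply: memvZ.
  have <- : #|val (facet a y)| = j.+1 by rewrite card_facet // aj.
  apply: chains_sub (sd_chains k _).1; rewrite -DcxE.
  apply: (bigcup_sup (facet a y)); apply/andP; split.
    by apply/coversP; exists y; rewrite ?val_facet.
  rewrite lE -(inj_eq val_inj) !val_facet; apply: contraNneq yx => /setP/(_ x).
  by rewrite !inE eqxx xa andbT /= eq_sym => /negbFE.
have Dv b (F : {set P}) v : F \in Dcx b -> F :\ v \in Dcx b.
  by rewrite !DcxE; apply/OC_facet/subD1set.
have Ev (F : {set P}) v : F \in Dother a l -> F :\ v \in Dother a l.
  by move=> /bigcupP[b ba Fb]; apply/bigcupP; exists b => //; apply: Dv.
have bd0 : bd k P (c' + c'') = 0 by rewrite -sE bd_sd_sphere.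
have bdc' : bd k P c' = psign k x (val a) *: sphere l by rewrite linearZ /= bd_sd_simplex.
rewrite /sphere_class /phi comp_lfunE (Delta_other la) sE mv_connect_hclass //; last exact: Dv.
rewrite hclass_sub ?Delta2_sub //; first by rewrite bdc' linearZ.
apply/cyclesP; split; last by rewrite bd_bd.
have b1 : bd k P c' \in chains k (Dcx l) j by apply: bd_chains => //; exact: Dv.
(* As [c' + c''] is a cycle, [bd c'] is also [- bd c''], so it is carried by the intersection of the
   two parts. *)
have b2 : bd k P c' \in chains k (Dother a l) j.
  have -> : bd k P c' = - bd k P c''.
    by apply/eqP; rewrite -addr_eq0 -linearD /= bd0.
  by rewrite memvN; apply: bd_chains.
apply/chainsP => F nz; have /chainsP/(_ F nz)[F1 Fj] := b1.
by have /chainsP/(_ F nz)[F2 _] := b2; rewrite inE F1 F2.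
Qed.

(** The enumeration of ['I_r] is its natural order, so the simplicial signs are those of the Scarf
    differential. *)
Lemma psign_ord (J : {set 'I_r}) (x : 'I_r) :
  psign k x J = (-1) ^+ #|[set y in J | (y < x)%N]|.
Proof. by congr (_ ^+ _); apply: eq_card => y; rewrite !inE !enum_rank_ord. Qed.

Lemma scarf_entryE i (I : scarf_gen m i.+1) (J : scarf_gen m i) x :
    x \in val I -> val J = val I :\ x ->
  scarf_entry k I J = psign k x (val I) *: 'X_[mlcms m (val I) - mlcms m (val J)].
Proof.
move=> xI JE; rewrite /scarf_entry psign_ord (bigD1 x) ?xI ?JE ?eqxx //= big1 ?addr0 //.
move=> y /andP[/andP[yI /eqP E] yx]; have /setP/(_ x) := E.
by rewrite !inE eqxx xI eq_sym yx.
Qed.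

Definition eta_face i : eta_gen k P i -> P :=
  match i with 0 => fun=> \bot | j.+1 => fun e => val (tag e) end.

Definition eta_vec i : eta_gen k P i -> chain :=
  match i with
  | 0 => fun e => (vbasis (C0 k P))`_e
  | j.+1 => fun e => (vbasis (Cpos k j (val (tag e))))`_(tagged e)
  end.

Definition eta_class i a : chain :=
  if i is j.+1 then sphere_class j a else point_class.

(** The basis vector picked by [vbasis] on a line is known only up to a nonzero scalar; these
    scalars become the [u] of [minimal_free_resolution_iso]. *)
Lemma vbasis_line (V : {vspace chain}) (v : chain) (e : 'I_(\dim V)) :
  V = <[v]>%VS -> exists2 u : k, u != 0 & (vbasis V)`_e = u *: v.
Proof.
move=> VE; have lt : (e < size (vbasis V))%N by rewrite size_tuple.
have : (vbasis V)`_e \in <[v]>%VS by rewrite -VE vbasis_mem ?mem_nth.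
case/vlineP=> u E; exists u => //.
apply: contraTneq (free_not0 (basis_free (vbasisP V)) (mem_nth 0 lt)) => u0.
by rewrite E u0 scale0r eqxx.
Qed.

Lemma eta_gen_card j (e : eta_gen k P j.+1) : #|val (eta_face e)| = j.+1.
Proof.
case: e => [[a a0] e] /=; apply/eqP/negPn/negP => aj.
have dim0 : \dim (Cpos k j a) = 0%N by rewrite (Cpos_eq0 a0 aj) dimv0.
by move: e; rewrite /= dim0 => -[].
Qed.

Lemma eta_gen_data i (e : eta_gen k P i) :
  exists z : scarf_gen m i * k, [/\ val z.1 = val (eta_face e), z.2 != 0
    & eta_vec e = z.2 *: eta_class i (eta_face e)].
Proof.
case: i e => [|j] e.
  have h : (set0 \in scarf m) && (#|set0 : {set 'I_r}| == 0%N) by rewrite h0 cards0.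
  have [u u0 uE] := vbasis_line e C0E.
  pose I : scarf_gen m 0 :=
    exist (fun I : {set 'I_r} => is_true ((I \in scarf m) && (#|I| == 0%N))) _ h.
  by exists (I, u).
have h : (val (eta_face e) \in scarf m) && (#|val (eta_face e)| == j.+1).
  by rewrite eta_gen_card eqxx andbT; apply: valP.
have [u u0 uE] := vbasis_line (tagged e) (CposE (valP (tag e)) (eta_gen_card e)).
pose I : scarf_gen m j.+1 :=
  exist (fun I : {set 'I_r} => is_true ((I \in scarf m) && (#|I| == j.+1))) _ h.
by exists (I, u).
Qed.

Lemma eta_face_inj i (e e' : eta_gen k P i) : eta_face e = eta_face e' -> e = e'.
Proof.
case: i e e' => [|j].
  move=> /= e e' _; move: e e'; have -> : \dim (C0 k P) = 1%N.
    by rewrite C0E dim_vline point_class_neq0.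
  by move=> e e'; rewrite !ord1.
move=> e e'; have := eta_gen_card e; case: e e' => [a e] [a' e'] /= aj E.
have aa : a = a' by apply: val_inj.
case: _ / aa e' {E} => e'; congr existT; move: e e'.
(* Once the faces agree, both indices lie in ['I_1], as [Cpos] is a line for a face of size
   [j.+1]. *)
have -> : \dim (Cpos k j (val a)) = 1%N.
  by rewrite (CposE (valP a) aj) dim_vline sphere_class_neq0 ?(valP a).
by move=> e e'; rewrite !ord1.
Qed.

Lemma eta_face_surj i (I : scarf_gen m i) : exists e : eta_gen k P i, val (eta_face e) = val I.
Proof.
case: i I => [|j] [I /= /andP[IS /eqP Ii]].
  have d : (0 < \dim (C0 k P))%N by rewrite C0E dim_vline point_class_neq0.
  by exists (Ordinal d) => /=; apply/esym/eqP; rewrite -cards_eq0 Ii.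
pose a : P := exist _ I IS.
have a0 : a != \bot by rewrite face_neq0 /= -card_gt0 Ii.
have d : (0 < \dim (Cpos k j a))%N.
  by rewrite (CposE a0 Ii) dim_vline sphere_class_neq0.
by exists (existT (fun a : {a : P | a != \bot} => 'I_(\dim (Cpos k j (val a))))
            (exist _ a a0) (Ordinal d)).
Qed.

Lemma coord_vbasis_line (V : {vspace chain}) (e : 'I_(\dim V)) (w : chain) (t : k) :
  w = t *: (vbasis V)`_e -> coord (vbasis V) e w = t.
Proof.
by move=> ->; rewrite linearZ /= coord_free ?(basis_free (vbasisP V)) // eqxx mulr1.
Qed.

(** The scalars [u] and [u'] replace the [vbasis] vectors by sphere classes, between which the maps
    act by the signs of [phi1_sphere] and [phi_sphere]. *)
Lemma eta_entry_scarf i (e : eta_gen k P i.+1) (e' : eta_gen k P i)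
    (I : scarf_gen m i.+1) (J : scarf_gen m i) (u u' : k) :
    val I = val (eta_face e) -> val J = val (eta_face e') -> u' != 0 ->
    eta_vec e = u *: eta_class i.+1 (eta_face e) ->
    eta_vec e' = u' *: eta_class i (eta_face e') ->
  u' *: eta_entry (scarf_eta (h0 := h0)) e e' = u *: scarf_entry k I J.
Proof.
move=> Ie Je u'0 vE v'E; have ei := eta_gen_card e.
have pull (c d : k) : c = u * d / u' -> u' * c = u * d.
  by move=> ->; rewrite mulrC mulfVK.
case: i e e' I J Ie Je vE v'E ei => [|i] e e' I J Ie Je vE v'E ei /=.
  have /cards1P[x ax] : #|val (eta_face e)| == 1%N by rewrite ei.
  have xI : x \in val I by rewrite Ie ax set11.
  have J0 : val J = val I :\ x.
    by rewrite Je Ie ax; apply/setP => y; rewrite !inE; case: eqP.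
  rewrite (scarf_entryE xI J0) !scalerA Je /= {2}/mlcms big_set0 Ie.
  rewrite /scarf_eta (_ : (_ - 0)%MM = mlcms m (val (eta_face e))); last first.
    by apply/mnmP => y; rewrite mnmBE mnm0E subn0.
  congr (_ *: _); apply: pull; apply: coord_vbasis_line.
  move: vE v'E => /= -> ->; rewrite linearZ /= (phi1_sphere ax) !scalerA.
  by rewrite mulfVK // Ie.
(* Without a cover relation the smaller face does not arise by deleting one vertex, and the Scarf
   entry is an empty sum. *)
case: ifP => [la|nla]; last first.
  rewrite scaler0 /scarf_entry big_pred0 ?scaler0 // => x; apply/negP.
  rewrite Ie Je => /andP[xI /eqP E]; case/negP: (negbT nla).
  by apply/coversP; exists x.
have /coversP[x xa lx] := la.
rewrite (@scarf_entryE _ I J x) ?Ie ?Je // !scalerA; congr (_ *: _).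
apply: pull; apply: coord_vbasis_line.
apply: etrans (congr1 (phi k i _ _) vE) _.
apply: etrans _ (congr1 (fun w => _ *: w) (esym v'E)).
by rewrite linearZ /= (phi_sphere la (valP (tag e')) ei xa lx) !scalerA mulfVK.
Qed.

(** Each generator of F(eta) is matched with the Scarf generator of the same face and with its
    scalar; the matching is bijective because [Cpos] is a line in the degree given by the size of
    the face and 0 in the others. *)
Theorem eta_resolution : scarf_ideal m k ->
  minimal_free_resolution (@monideal n r m k) (eta_seq k (scarf_eta (h0 := h0))).
Proof.
have Z i := functional_choice _ (@eta_gen_data i).
pose z i := sval (constructive_indefinite_description _ (Z i)).
have zP i e : [/\ val (z i e).1 = val (eta_face e), (z i e).2 != 0
    & eta_vec e = (z i e).2 *: eta_class i (eta_face e)].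
  exact: (svalP (constructive_indefinite_description _ (Z i))).
apply: (@minimal_free_resolution_iso k n (eta_seq k (scarf_eta (h0 := h0)))
  (scarf_seq m k) (fun i e => (z i e).1) (fun i e => (z i e).2)) => i.
- have [g gP] := functional_choice _ (@eta_face_surj i).
  have gK : cancel g (fun e => (z i e).1).
    by move=> I; apply: val_inj; have [-> _ _] := zP i (g I).
  exists g => // e; apply: eta_face_inj; apply: val_inj.
  by rewrite gP; have [-> _ _] := zP i e.
- by move=> e; have [] := zP i e.
- move=> e; have [E _ _] := zP i e; rewrite /= /scarf_deg E.
  case: i e {E} => [|i] e //=; rewrite /mlcms big_set0.
  by apply/ffunP => x; rewrite !ffunE mnm0E.
move=> e e'; have [Ie _ vE] := zP i.+1 e; have [Je u0 v'E] := zP i e'.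
exact: eta_entry_scarf.
Qed.

End EtaScarf.

Theorem proposition5p4 (k : fieldType) (n r : nat) (m : 'I_r -> 'X_{1..n})
    (hmin : minimal_generators m) (hprop : proper_monideal m k) :
  scarf_ideal m k ->
  lattice_linear m k /\
  minimal_free_resolution (@monideal n r m k)
    (eta_seq k (scarf_eta (h0 := scarf0 hprop))).
Proof.
by move=> scN; split; [apply: scarf_lattice_linear|apply: eta_resolution].
Qed.
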